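(* Let $m\ge 1$ be an integer. Assume that $\tilde u(z,0)$ and $\tilde v(z,0)$ are in $C^m[0,1]$ and periodic in $z$ with period $1$, with $\int_0^1\tilde v(z,0)\,dz=0$. Then the solution $(\tilde u,\tilde v)$ of the 1D inviscid model $$\tilde u_t+2\tilde\psi\,\tilde u_z=-2\tilde v\tilde u,$$ $$\tilde v_t+2\tilde\psi\,\tilde v_z=\tilde u^2-\tilde v^2+c(t),$$ with $\tilde v=-\tilde\psi_z$ and $$c(t)=3\int_0^1\tilde v^2\,dz-\int_0^1\tilde u^2\,dz,$$ exists and is in $C^m[0,1]$ (as a function of $z$) for all times $t\ge 0$.
   Context: All functions $\tilde u,\tilde v,\tilde\psi$ are real-valued functions of $(z,t)$, periodic in $z$ with period $1$. ''In $C^m[0,1]$ and periodic with period $1$'' means that the 1-periodic function is of class $C^m$ in $z$. The function $\tilde\psi$ is a 1-periodic function of $z$ with $\tilde\psi_z=-\tilde v$. This determines $\tilde\psi$ up to an additive function of $t$: $\tilde\psi(z,t)=a(t)-\int_0^z\tilde v(z',t)\,dz'$, where $a$ is an arbitrary prescribed continuous function of $t$ (for instance $a\equiv 0$). The term $c(t)$ is the constant of integration that enforces $\int_0^1\tilde v(z,t)\,dz=0$ for all $t$. *)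

(* Defs.v *)
(* Stdlib reals with Coquelicot. *)
From Stdlib Require Export Reals.
From Coquelicot Require Export Coquelicot.
Open Scope R_scope.

Definition periodic1 (f : R -> R) : Prop := forall z, f (z + 1) = f z.

(* Class C^m on the whole line: for a 1-periodic function this is C^m on the
   circle, so derivatives also match across the endpoints of [0,1]. *)
Definition Cm (m : nat) (f : R -> R) : Prop :=
  forall k : nat, (k <= m)%nat ->
  forall z : R, ex_derive_n f k z /\ continuous (Derive_n f k) z.

(* Derivative at t relative to the half-line [0, +oo): the usual derivative
   when t > 0, the right derivative when t = 0. *)
Definition is_derive_t (f : R -> R) (t l : R) : Prop :=
  filterdiff f (within (fun s : R => 0 <= s) (locally t))
    (fun h : R => scal h l).

Definition continuous_half_plane (f : R -> R -> R) : Prop :=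
  continuous_on (fun p : R * R => 0 <= snd p)
    (fun p : R * R => f (fst p) (snd p)).

(* [f : z -> t -> R] is of class C^1 on R x [0, +oo), with partial derivatives
   [fz] and [ft]. *)
Definition C1_half_plane (f fz ft : R -> R -> R) : Prop :=
  (forall z t, 0 <= t -> is_derive (fun y => f y t) z (fz z t)) /\
  (forall z t, 0 <= t -> is_derive_t (fun s => f z s) t (ft z t)) /\
  continuous_half_plane f /\
  continuous_half_plane fz /\
  continuous_half_plane ft.

Definition c_of (u v : R -> R -> R) (t : R) : R :=
  3 * RInt (fun z => (v z t) ^ 2) 0 1 - RInt (fun z => (u z t) ^ 2) 0 1.

(* Global classical solution of the 1D inviscid model with initial data
   [u0, v0]. The stream function is normalized by psi(0,t) = a(t), so it equals
   a(t) - int_0^z v(z',t) dz'; its periodicity encodes int_0^1 v(z,t) dz = 0.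
   Values at negative times are irrelevant. *)
Definition is_solution (a u0 v0 : R -> R) (u v psi : R -> R -> R) : Prop :=
  (forall z, u z 0 = u0 z /\ v z 0 = v0 z) /\
  (forall t, 0 <= t ->
     periodic1 (fun z => u z t) /\ periodic1 (fun z => v z t) /\
     periodic1 (fun z => psi z t)) /\
  (forall z t, 0 <= t -> is_derive (fun y => psi y t) z (- v z t)) /\
  (forall t, 0 <= t -> psi 0 t = a t) /\
  exists uz ut vz vt : R -> R -> R,
    C1_half_plane u uz ut /\
    C1_half_plane v vz vt /\
    forall z t, 0 <= t ->
      ut z t + 2 * psi z t * uz z t = - 2 * v z t * u z t /\
      vt z t + 2 * psi z t * vz z t
        = (u z t) ^ 2 - (v z t) ^ 2 + c_of u v t.

(* Main.v *)
(* Idea. Along particle paths z = Z(x,t) with Jacobian J = Z_x, the model gives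
   u = u0(x) J and v = - J_t / (2 J), so that w = J^(-1/2) solves the Ermakov equation
   w_tt = c(t) w + u0^2 / w^3. Its solutions are w = |phi1 (1,0) + phi2 (v0,u0)| with
   phi'' = c phi and Wronskian 1. In polar coordinates
   (phi1, phi2) = sqrt(G) (cos th, sin th) this reads J = 1 / (G K) with
   K(x,th) = (cos th + v0 sin th)^2 + (u0 sin th)^2. The mean condition int J dx = 1 forces
   G(th) = int dx / K(x,th), and the Wronskian condition becomes the autonomous scalar
   equation th' = 1 / G(th).

   Since u0 and v0 are C^1, sqrt(K) is Lipschitz in x, hence 1 / G is at most a constant
   times sqrt(K(x,th)) for every x. Therefore 1 / G, extended by 0, is globally Lipschitz: th
   exists for all times and never reaches an angle where K vanishes. This is global existence.
   The normalization of psi at z = 0 is an ordinary differential equation for the label of the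
   particle at z = 0, and the inverse map x = A(z,t) satisfies A_z = G K(A,th), which gives
   the C^m regularity. Uniqueness is an L^2 energy estimate. *)

(* The obstacle is that [G] integrates [1 / K], and no lower bound on [K] is available in advance,
   so the Lipschitz bound for [1 / G] has to be uniform up to the singular angles. If [sqrt K] has
   size n at one label, it keeps that size over a length comparable to n, so [G] is at least of
   order n / n^2. A factor [1 / sqrt K] can therefore be paid for by [G] itself, and these factors
   of [G] cancel in the difference of two values of [1 / G].

   The angle is at first only differentiable, while [v] contains [th''] and [v_t] contains [th'''].
   The missing derivatives come from differentiating [G] under the integral sign along the
   trajectory.

   The formula for c(t) is never imposed: the construction yields a v-equation with some function of
   t, and the periodicity of psi forces its value.

   Everything is built for all real times. One-sided time derivatives occur only in the translation
   to the final statement and for the solutions compared in the uniqueness proof, where time is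
   clamped by [Rmax 0]. *)
Require Import Defs.
From Stdlib Require Import Reals Lra Lia ZArith Classical ClassicalEpsilon.
From Coquelicot Require Import Coquelicot.
Open Scope R_scope.


(** * Continuity and integrals with a parameter *)

(* Coquelicot's canonical structures hide the type R from ring and field. *)
Ltac eqR := match goal with |- @eq _ ?x ?y => change (@eq R x y) end.

Section ContinuousOps.
Context {T : UniformSpace}.
Implicit Types (f g : T -> R) (p : T).

Lemma cts_plus f g p : continuous f p -> continuous g p -> continuous (fun q => f q + g q) p.
Proof. exact (@continuous_plus T R_AbsRing R_NormedModule f g p). Qed.

Lemma cts_minus f g p : continuous f p -> continuous g p -> continuous (fun q => f q - g q) p.
Proof. exact (@continuous_minus T R_AbsRing R_NormedModule f g p). Qed.

Lemma cts_opp f p : continuous f p -> continuous (fun q => - f q) p.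
Proof. exact (@continuous_opp T R_AbsRing R_NormedModule f p). Qed.

Lemma cts_mult f g p : continuous f p -> continuous g p -> continuous (fun q => f q * g q) p.
Proof. exact (@continuous_mult T R_AbsRing f g p). Qed.

Lemma cts_const (c : R) p : continuous (fun _ : T => c) p.
Proof. apply continuous_const. Qed.

Lemma cts_comp (h : R -> R) f p :
  continuous h (f p) -> continuous f p -> continuous (fun q => h (f q)) p.
Proof. intros Hh Hf. exact (continuous_comp f h p Hf Hh). Qed.

Lemma cts_inv f p : f p <> 0 -> continuous f p -> continuous (fun q => / f q) p.
Proof.
  intros Hp Hf. apply cts_comp; [|exact Hf].
  apply continuity_pt_filterlim, continuity_pt_inv; [|exact Hp].
  apply continuity_pt_id.
Qed.

Lemma cts_div f g p :
  g p <> 0 -> continuous f p -> continuous g p -> continuous (fun q => f q / g q) p.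
Proof. intros Hp Hf Hg. apply cts_mult; [exact Hf|]. now apply cts_inv. Qed.

Lemma cts_pow f n p : continuous f p -> continuous (fun q => f q ^ n) p.
Proof.
  intros Hf. induction n as [|n IH]; simpl; [apply cts_const|now apply cts_mult].
Qed.

Lemma cts_sin f p : continuous f p -> continuous (fun q => sin (f q)) p.
Proof.
  apply cts_comp, continuity_pt_filterlim, continuity_sin.
Qed.

Lemma cts_cos f p : continuous f p -> continuous (fun q => cos (f q)) p.
Proof.
  apply cts_comp, continuity_pt_filterlim, continuity_cos.
Qed.

Lemma cts_exp f p : continuous f p -> continuous (fun q => exp (f q)) p.
Proof.
  apply cts_comp, continuity_pt_filterlim, derivable_continuous, derivable_exp.
Qed.

Lemma cts_abs f p : continuous f p -> continuous (fun q => Rabs (f q)) p.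
Proof.
  apply cts_comp, continuity_pt_filterlim, Rcontinuity_abs.
Qed.
End ContinuousOps.

(** Continuity is asked on the whole plane, not on t >= 0, so that integrals with a parameter can be
    treated with two-sided limits. Functions known only for t >= 0 are brought to this form by
    clamping time. *)
Definition cont2 (f : R -> R -> R) : Prop :=
  forall p : R * R, continuous (fun q : R * R => f (fst q) (snd q)) p.

Lemma cts_fst (p : R * R) : continuous (fun q : R * R => fst q) p.
Proof. destruct p; apply continuous_fst. Qed.

Lemma cts_snd (p : R * R) : continuous (fun q : R * R => snd q) p.
Proof. destruct p; apply continuous_snd. Qed.

Lemma cts_comp2 {T : UniformSpace} (h : R -> R -> R) (f g : T -> R) (p : T) :
  cont2 h -> continuous f p -> continuous g p -> continuous (fun q => h (f q) (g q)) p.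
Proof.
  intros Hh Hf Hg.
  exact (continuous_comp_2 f g h p Hf Hg (Hh (f p, g p))).
Qed.

Lemma cts_id (x : R) : continuous (fun y : R => y) x.
Proof. apply continuous_id. Qed.

(** Reduction by the outermost operation, with continuity hypotheses in context as leaves.
    Nonvanishing of denominators is left to the user. *)
Ltac cts_step :=
  lazymatch goal with
  | |- continuous (fun q => fst q) _ => apply cts_fst
  | |- continuous fst _ => apply cts_fst
  | |- continuous (fun q => snd q) _ => apply cts_snd
  | |- continuous snd _ => apply cts_snd
  | |- continuous (fun q => q) _ => apply cts_id
  | |- continuous (fun q => @?f q + @?g q) _ => apply (cts_plus f g)
  | |- continuous (fun q => @?f q - @?g q) _ => apply (cts_minus f g)
  | |- continuous (fun q => - @?f q) _ => apply (cts_opp f)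
  | |- continuous (fun q => @?f q * @?g q) _ => apply (cts_mult f g)
  | |- continuous (fun q => @?f q / @?g q) _ => apply (cts_div f g)
  | |- continuous (fun q => / @?f q) _ => apply (cts_inv f)
  | |- continuous (fun q => @?f q ^ ?n) _ => apply (cts_pow f n)
  | |- continuous (fun q => sin (@?f q)) _ => apply (cts_sin f)
  | |- continuous (fun q => cos (@?f q)) _ => apply (cts_cos f)
  | |- continuous (fun q => exp (@?f q)) _ => apply (cts_exp f)
  | |- continuous (fun q => Rabs (@?f q)) _ => apply (cts_abs f)
  | H : cont2 ?h |- continuous (fun q => ?h (@?f q) (@?g q)) _ =>
      apply (cts_comp2 h f g _ H)
  | H : cont2 ?h |- continuous (?h ?x) _ =>
      apply (cts_comp2 h (fun _ => x) (fun q => q) _ H)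
  | H : forall x, continuous ?h x |- continuous ?h _ => apply H
  | H : forall x, continuous ?h x |- continuous (fun q => ?h (@?f q)) _ =>
      apply (cts_comp h f); [apply H|]
  | |- continuous _ _ => apply cts_const
  end.

Ltac cts := repeat (cts_step; cbv beta).

Lemma cont2_pt f x y : cont2 f -> continuity_2d_pt f x y.
Proof. intros H. apply continuity_2d_pt_filterlim, (H (x, y)). Qed.

Lemma cont2_l f (t : R) : cont2 f -> forall x, continuous (fun x => f x t) x.
Proof. intros H x. cts. Qed.

Lemma cont2_r f (x : R) : cont2 f -> forall t, continuous (f x) t.
Proof. intros H t. cts. Qed.

Lemma is_derive_cts (f : R -> R) x l : is_derive f x l -> continuous f x.
Proof. intros H. apply (ex_derive_continuous f). now exists l. Qed.

Lemma ex_RInt_cts (f : R -> R) a b : (forall x, continuous f x) -> ex_RInt f a b.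
Proof. intros H. apply (ex_RInt_continuous f). intros; apply H. Qed.

Lemma RInt_plus_cts (f g : R -> R) a b :
  (forall x, continuous f x) -> (forall x, continuous g x) ->
  RInt (fun x => f x + g x) a b = RInt f a b + RInt g a b.
Proof.
  intros Hf Hg. apply (RInt_plus (V := R_CompleteNormedModule) f g); now apply ex_RInt_cts.
Qed.

Lemma RInt_minus_cts (f g : R -> R) a b :
  (forall x, continuous f x) -> (forall x, continuous g x) ->
  RInt (fun x => f x - g x) a b = RInt f a b - RInt g a b.
Proof.
  intros Hf Hg. apply (RInt_minus (V := R_CompleteNormedModule) f g); now apply ex_RInt_cts.
Qed.

Lemma RInt_scal_cts (f : R -> R) (c : R) a b : (forall x, continuous f x) ->
  RInt (fun x => c * f x) a b = c * RInt f a b.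
Proof.
  intros Hf. apply (RInt_scal (V := R_CompleteNormedModule) f a b c); now apply ex_RInt_cts.
Qed.

Lemma RInt_const_R (a b c : R) : RInt (fun _ => c) a b = (b - a) * c.
Proof. exact (RInt_const (V := R_CompleteNormedModule) a b c). Qed.

Lemma RInt_Chasles_cts (f : R -> R) a b c : (forall x, continuous f x) ->
  RInt f a b + RInt f b c = RInt f a c.
Proof. intros Hf. apply (RInt_Chasles f); now apply ex_RInt_cts. Qed.

Lemma is_derive_RInt_cts (f : R -> R) a : (forall x, continuous f x) ->
  forall x, is_derive (fun y => RInt f a y) x (f x).
Proof.
  intros H x. apply (is_derive_RInt f (fun y => RInt f a y) a x); [|apply H].
  apply filter_forall. intros y. apply (RInt_correct f), ex_RInt_cts, H.
Qed.

Lemma RInt_of_derive (f df : R -> R) a b :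
  (forall x, is_derive f x (df x)) -> (forall x, continuous df x) ->
  RInt df a b = f b - f a.
Proof.
  intros Hd Hc. apply is_RInt_unique.
  apply (is_RInt_derive f df); intros; [apply Hd|apply Hc].
Qed.

(** Differentiability is asked only near [t]: in the energy argument the integrand is differentiable
    in time only at positive times. *)
Lemma is_derive_RInt_cont2 (F Ft : R -> R -> R) a b t :
  locally t (fun s => forall x, is_derive (F x) s (Ft x s)) ->
  cont2 F -> cont2 Ft ->
  is_derive (fun s => RInt (fun x => F x s) a b) t (RInt (fun x => Ft x t) a b).
Proof.
  intros Hd HF HFt.
  rewrite (RInt_ext (fun x => Ft x t) (fun x => Derive (F x) t)).
  2:{ intros x _. symmetry. apply is_derive_unique, (locally_singleton _ _ Hd). }
  apply (is_derive_RInt_param (fun s x => F x s) a b t).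
  - apply (filter_imp (F := locally t)) with (2 := Hd).
    intros s Hs x _. exists (Ft x s). apply Hs.
  - intros x _.
    apply continuity_2d_pt_ext_loc with (fun s y => Ft y s).
    + destruct Hd as [d Hd]. exists d. intros s y Hs _. symmetry.
      apply is_derive_unique, Hd. exact Hs.
    + apply (cont2_pt (fun s y => Ft y s)). intros p. cts.
  - apply filter_forall. intros s. apply ex_RInt_cts. now apply cont2_l.
Qed.

Lemma continuous_RInt_cont2 (F : R -> R -> R) a b : cont2 F ->
  forall t, continuous (fun s => RInt (fun x => F x s) a b) t.
Proof.
  intros HF.
  assert (main : forall a b, a <= b -> forall t, continuous (fun s => RInt (fun x => F x s) a b) t).
  { clear a b. intros a b Hab t.
    apply filterlim_locally. intros eps.
    (* The summand 1 keeps the denominator positive when [a = b]. *)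
    assert (He : 0 < eps / (b - a + 1)).
    { apply Rdiv_lt_0_compat; [apply cond_pos|lra]. }
    destruct (uniform_continuity_2d_1d F a b t) with (eps := mkposreal _ He) as [d Hd].
    { intros x _. now apply cont2_pt. }
    exists d. intros s Hs. change (Rabs (s - t) < d) in Hs.
    change (Rabs (RInt (fun x => F x s) a b - RInt (fun x => F x t) a b) < eps).
    rewrite <- (RInt_minus_cts (fun x => F x s) (fun x => F x t)) by now apply cont2_l.
    apply Rle_lt_trans with ((b - a) * (eps / (b - a + 1))).
    - apply abs_RInt_le_const; [exact Hab| |].
      + apply (ex_RInt_cts (fun x => F x s - F x t)). intros x. cts.
      + intros x Hx. apply Rlt_le. 
        apply (Hd x t x s); try assumption; try (split; apply Rabs_def2 in Hs; destruct d; simpl in *; lra).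
        rewrite Rminus_diag, Rabs_R0. apply cond_pos.
    - apply Rlt_le_trans with ((b - a + 1) * (eps / (b - a + 1))).
      + apply Rmult_lt_compat_r; [exact He|lra].
      + right. field. lra. }
  intros t. destruct (Rle_dec a b) as [H|H]; [now apply main|].
  apply continuous_ext with (fun s => - RInt (fun x => F x s) b a).
  - intros s. apply (opp_RInt_swap (fun x => F x s)). apply ex_RInt_cts. now apply cont2_l.
  - apply cts_opp, main. lra.
Qed.

Lemma mean_value (f df : R -> R) a b :
  (forall x, is_derive f x (df x)) ->
  exists c, Rmin a b <= c <= Rmax a b /\ f b - f a = df c * (b - a).
Proof.
  intros H. apply MVT_gen; intros x _; [apply H|].
  apply continuity_pt_filterlim, (is_derive_cts f x _ (H x)).
Qed.

Lemma abs_between a b c : Rmin a b <= c <= Rmax a b -> Rabs (c - a) <= Rabs (b - a).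
Proof.
  unfold Rmin, Rmax. destruct (Rle_dec a b); intros Hc;
  unfold Rabs; destruct (Rcase_abs (c - a)), (Rcase_abs (b - a)); lra.
Qed.

(** The increment is split at [(x0, t)]. The part along x is controlled by the local bound
    [|fx x0 t0| + 1] on [fx], the part along t by continuity on the single line [x = x0]. This
    serves for integrals with a variable end point, whose dependence on t is known one x at a
    time. *)
Lemma cont2_of_derive_l (f fx : R -> R -> R) :
  (forall x t, is_derive (fun y => f y t) x (fx x t)) -> cont2 fx ->
  (forall x t, continuous (f x) t) -> cont2 f.
Proof.
  intros Hd Hfx Hc [x0 t0]. apply filterlim_locally. intros eps.
  pose proof (proj1 (filterlim_locally _ _) (Hfx (x0, t0)) (mkposreal 1 Rlt_0_1)) as [d1 H1].
  assert (He : 0 < eps / 2) by (destruct eps; simpl; lra).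
  pose proof (proj1 (filterlim_locally _ _) (Hc x0 t0) (mkposreal _ He)) as [d2 H2].
  set (M := Rabs (fx x0 t0) + 1).
  assert (HM : 0 < M) by (unfold M; pose proof (Rabs_pos (fx x0 t0)); lra).
  assert (H3 : 0 < eps / 2 / M) by now apply Rdiv_lt_0_compat.
  assert (Hd' : 0 < Rmin d1 (Rmin d2 (eps / 2 / M))).
  { repeat apply Rmin_glb_lt; try apply cond_pos; exact H3. }
  exists (mkposreal _ Hd'). intros [x t] [Hx Ht].
  change (Rabs (x - x0) < Rmin d1 (Rmin d2 (eps / 2 / M))) in Hx.
  change (Rabs (t - t0) < Rmin d1 (Rmin d2 (eps / 2 / M))) in Ht.
  change (Rabs (f x t - f x0 t0) < eps).
  pose proof (Rmin_l d1 (Rmin d2 (eps / 2 / M))) as L1.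
  pose proof (Rmin_r d1 (Rmin d2 (eps / 2 / M))) as L2.
  pose proof (Rmin_l d2 (eps / 2 / M)) as L3.
  pose proof (Rmin_r d2 (eps / 2 / M)) as L4.
  destruct (mean_value (fun y => f y t) (fun y => fx y t) x0 x) as [c [Hc1 Hc2]].
  { intros y. apply Hd. }
  apply abs_between in Hc1.
  assert (B1 : Rabs (fx c t) < M).
  { assert (Hb : Rabs (fx c t - fx x0 t0) < 1).
    { apply (H1 (c, t)). split; [change (Rabs (c - x0) < d1)|change (Rabs (t - t0) < d1)]; lra. }
    pose proof (Rabs_triang (fx c t - fx x0 t0) (fx x0 t0)) as Htr.
    replace (fx c t - fx x0 t0 + fx x0 t0) with (fx c t) in Htr by ring.
    unfold M. lra. }
  assert (B2 : Rabs (f x0 t - f x0 t0) < eps / 2).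
  { apply (H2 t). change (Rabs (t - t0) < d2). lra. }
  replace (f x t - f x0 t0) with ((f x t - f x0 t) + (f x0 t - f x0 t0)) by ring.
  apply Rle_lt_trans with (1 := Rabs_triang _ _).
  cut (Rabs (f x t - f x0 t) <= eps / 2); [lra|].
  rewrite Hc2, Rabs_mult.
  replace (eps / 2) with (M * (eps / 2 / M)) by (field; lra).
  apply Rmult_le_compat; try apply Rabs_pos; lra.
Qed.

(** The bound is hidden in a gauge: around each point the radius is chosen at most [/ (|f| + 1)].
    Compactness gives a positive lower bound [d] for the radii that matter, and [/ d] then bounds
    [f]. *)
Lemma cont2_bounded (f : R -> R -> R) a b a' b' : cont2 f ->
  exists M, 0 <= M /\ forall x y, a <= x <= b -> a' <= y <= b' -> Rabs (f x y) <= M.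
Proof.
  intros Hf.
  assert (H : forall u v, exists d : posreal, d <= / (Rabs (f u v) + 1) /\
    forall x y, Rabs (x - u) < d -> Rabs (y - v) < d -> Rabs (f x y) <= Rabs (f u v) + 1).
  { intros u v.
    destruct (cont2_pt f u v Hf (mkposreal 1 Rlt_0_1)) as [d Hd]. simpl in Hd.
    assert (P : 0 < / (Rabs (f u v) + 1)).
    { apply Rinv_0_lt_compat. pose proof (Rabs_pos (f u v)). lra. }
    assert (Q : 0 < Rmin d (/ (Rabs (f u v) + 1))) by (apply Rmin_glb_lt; [apply cond_pos|exact P]).
    exists (mkposreal _ Q). simpl. split; [apply Rmin_r|].
    intros x y Hx Hy.
    pose proof (Rmin_l d (/ (Rabs (f u v) + 1))).
    assert (E : Rabs (f x y - f u v) < 1) by (apply Hd; lra).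
    pose proof (Rabs_triang (f x y - f u v) (f u v)) as Htr.
    replace (f x y - f u v + f u v) with (f x y) in Htr by ring. lra. }
  pose (dl := fun u v => proj1_sig (constructive_indefinite_description _ (H u v))).
  assert (Hdl : forall u v, dl u v <= / (Rabs (f u v) + 1) /\
    forall x y, Rabs (x - u) < dl u v -> Rabs (y - v) < dl u v -> Rabs (f x y) <= Rabs (f u v) + 1).
  { intros u v. exact (proj2_sig (constructive_indefinite_description _ (H u v))). }
  destruct (compactness_value_2d a b a' b' dl) as [d Hd].
  exists (/ d). split; [left; apply Rinv_0_lt_compat, cond_pos|].
  intros x y Hx Hy. apply NNPP. intros Hn. apply (Hd x y Hx Hy).
  intros (u & v & _ & _ & Hu & Hv & Hle). apply Hn.
  destruct (Hdl u v) as [H1 H2].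
  apply Rle_trans with (1 := H2 x y Hu Hv).
  rewrite <- (Rinv_inv (Rabs (f u v) + 1)).
  apply Rinv_le_contravar; [apply cond_pos|lra].
Qed.


(** * Ordinary differential equations *)

(** Negative times are reduced to positive ones by the reflection [s -> - s]; this lets the Picard
    iteration run in both time directions with one estimate. *)
Lemma abs_RInt_le_abs (g B : R -> R) t :
  (forall s, continuous g s) -> (forall s, continuous B s) ->
  (forall s, Rabs s <= Rabs t -> Rabs (g s) <= B (Rabs s)) ->
  Rabs (RInt g 0 t) <= RInt B 0 (Rabs t).
Proof.
  intros Hg HB H.
  assert (main : forall g t, 0 <= t -> (forall s, continuous g s) ->
    (forall s, 0 <= s <= t -> Rabs (g s) <= B s) -> Rabs (RInt g 0 t) <= RInt B 0 t).
  { clear g t Hg H. intros g t Ht Hg H.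
    apply Rle_trans with (RInt (fun s => Rabs (g s)) 0 t).
    - apply abs_RInt_le; [exact Ht|now apply ex_RInt_cts].
    - apply RInt_le; [exact Ht| |now apply ex_RInt_cts|].
      + apply ex_RInt_cts. intros s. cts.
      + intros s Hs. apply H. lra. }
  destruct (Rle_dec 0 t) as [Ht|Ht].
  - rewrite (Rabs_pos_eq t Ht). apply main; try assumption.
    intros s Hs. replace (B s) with (B (Rabs s)) by (rewrite Rabs_pos_eq; [reflexivity|lra]).
    apply H. rewrite !Rabs_pos_eq; lra.
  - rewrite (Rabs_left t) by lra.
    replace (RInt g 0 t) with (RInt (fun s => - g (- s)) 0 (- t)).
    + apply main; [lra|intros s; cts|].
      intros s Hs. rewrite Rabs_Ropp.
      replace (B s) with (B (Rabs (- s))) by (rewrite Rabs_Ropp, Rabs_pos_eq; [reflexivity|lra]).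
      apply H. rewrite Rabs_Ropp, Rabs_pos_eq, Rabs_left; lra.
    + transitivity (RInt g (-1 * 0 + 0) (-1 * - t + 0)).
      * rewrite <- (RInt_comp_lin g) by now apply ex_RInt_cts.
        apply RInt_ext. intros s _. change (- g (- s) = -1 * g (-1 * s + 0)).
        replace (-1 * s + 0) with (- s) by ring. ring.
      * f_equal; ring.
Qed.

Lemma half_pow_limit : is_lim_seq (fun n => (/ 2) ^ n) 0.
Proof. apply is_lim_seq_geom. rewrite Rabs_pos_eq; lra. Qed.

Lemma eq_of_half_pow_bound (x y K : R) :
  (forall n, Rabs (x - y) <= K * (/ 2) ^ n) -> x = y.
Proof.
  intros H.
  assert (L : is_lim_seq (fun n => K * (/ 2) ^ n) (Rbar_mult K 0)).
  { apply is_lim_seq_scal_l, half_pow_limit. }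
  simpl in L. rewrite Rmult_0_r in L.
  pose proof (is_lim_seq_le _ _ _ _ H (is_lim_seq_const (Rabs (x - y))) L) as E.
  simpl in E. pose proof (Rabs_pos (x - y)).
  apply Rminus_diag_uniq. destruct (Req_dec (x - y) 0) as [Z|Z]; [exact Z|].
  apply Rabs_pos_lt in Z. lra.
Qed.

Lemma exp_monotone x y : x <= y -> exp x <= exp y.
Proof.
  intros [H|H]; [left; now apply exp_increasing|right; now f_equal].
Qed.

Section Picard.
Context (f : R -> R -> R) (y0 : R).
Context (Hf : cont2 f).

Fixpoint picard_iter (n : nat) (t : R) : R :=
  match n with
  | O => y0
  | S n => y0 + RInt (fun s => f s (picard_iter n s)) 0 t
  end.

Lemma picard_iter_cts n t : continuous (picard_iter n) t.
Proof.
  revert t. induction n as [|n IH]; intros t; [apply cts_const|].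
  simpl. apply cts_plus; [apply cts_const|].
  apply (is_derive_cts _ _ (f t (picard_iter n t))).
  apply (is_derive_RInt_cts (fun s => f s (picard_iter n s))). intros s. cts.
Qed.

Lemma is_derive_picard_iter n t :
  is_derive (picard_iter (S n)) t (f t (picard_iter n t)).
Proof.
  simpl. rewrite <- (Rplus_0_l (f t (picard_iter n t))).
  apply (is_derive_plus (K := R_AbsRing) (V := R_NormedModule) (fun _ => y0)).
  - apply (@is_derive_const R_AbsRing R_NormedModule).
  - apply (is_derive_RInt_cts (fun s => f s (picard_iter n s))).
    pose proof (picard_iter_cts n) as Hc. intros s. cts.
Qed.

Context (T L : R) (L_pos : 0 < L).
Context (HT : forall t x y, Rabs t <= T ->
  Rabs (f t x) <= L /\ Rabs (f t x - f t y) <= L * Rabs (x - y)).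

(* The weight exp (2 L |t|) makes the Picard map a contraction of ratio 1/2. *)
Lemma picard_iter_step n t : Rabs t <= T ->
  Rabs (picard_iter (S n) t - picard_iter n t) <= (/ 2) ^ n * exp (2 * L * Rabs t).
Proof.
  assert (Ce : forall c x, continuous (fun s => c * exp (2 * L * s)) x).
  { intros c x. cts. }
  pose proof picard_iter_cts as Hc.
  revert t. induction n as [|n IH]; intros t Ht.
  - simpl. rewrite Rplus_minus_l.
    apply Rle_trans with (RInt (fun _ => L) 0 (Rabs t)).
    + apply abs_RInt_le_abs; [intros s; cts|intros s; cts|].
      intros s Hs. apply (HT s y0 y0). lra.
    + rewrite RInt_const_R.
      pose proof (exp_ineq1_le (2 * L * Rabs t)).
      assert (0 <= L * Rabs t) by (apply Rmult_le_pos; [lra|apply Rabs_pos]).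
      lra.
  - assert (E : picard_iter (S (S n)) t - picard_iter (S n) t =
      RInt (fun s => f s (picard_iter (S n) s) - f s (picard_iter n s)) 0 t).
    { pose proof (Hc n) as Hc1. pose proof (Hc (S n)) as Hc2.
      rewrite (RInt_minus_cts (fun s => f s (picard_iter (S n) s))
        (fun s => f s (picard_iter n s))) by (intros s; cts).
      simpl. ring. }
    rewrite E.
    apply Rle_trans with (RInt (fun s => L * (/ 2) ^ n * exp (2 * L * s)) 0 (Rabs t)).
    + apply abs_RInt_le_abs.
      * pose proof (Hc n) as Hc1. pose proof (Hc (S n)) as Hc2. intros s. cts.
      * apply Ce.
      * intros s Hs.
        destruct (HT s (picard_iter (S n) s) (picard_iter n s)) as [_ HH]; [lra|].
        apply Rle_trans with (1 := HH). rewrite Rmult_assoc.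
        apply Rmult_le_compat_l; [lra|]. apply IH. lra.
    + rewrite (RInt_of_derive (fun s => (/ 2) ^ n * / 2 * exp (2 * L * s))).
      * rewrite Rmult_0_r, exp_0. simpl.
        assert (0 < (/ 2) ^ n) by (apply pow_lt; lra). lra.
      * intros x. auto_derive; [trivial|]. field.
      * apply Ce.
Qed.

Let E := exp (2 * L * T).

Lemma picard_iter_diff n k t : Rabs t <= T ->
  Rabs (picard_iter (n + k) t - picard_iter n t) <= 2 * (/ 2) ^ n * E.
Proof.
  intros Ht.
  assert (HE : exp (2 * L * Rabs t) <= E).
  { apply exp_monotone. apply Rmult_le_compat_l; lra. }
  assert (Epos : 0 < E) by apply exp_pos.
  (* The factor [1 - (/ 2) ^ k] comes from the partial geometric sum; with it the induction on [k]
     closes. *)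
  cut (Rabs (picard_iter (n + k) t - picard_iter n t) <= 2 * (/ 2) ^ n * (1 - (/ 2) ^ k) * E).
  { intros H. apply Rle_trans with (1 := H). apply Rmult_le_compat_r; [lra|].
    assert (0 < (/ 2) ^ n) by (apply pow_lt; lra).
    assert (0 < (/ 2) ^ k) by (apply pow_lt; lra).
    rewrite <- (Rmult_1_r (2 * (/ 2) ^ n)) at 2. apply Rmult_le_compat_l; lra. }
  induction k as [|k IH].
  - rewrite Nat.add_0_r, Rminus_diag, Rabs_R0. simpl. lra.
  - rewrite Nat.add_succ_r.
    replace (picard_iter (S (n + k)) t - picard_iter n t) with
      ((picard_iter (S (n + k)) t - picard_iter (n + k) t) + (picard_iter (n + k) t - picard_iter n t)) by ring.
    apply Rle_trans with (1 := Rabs_triang _ _).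
    pose proof (picard_iter_step (n + k) t Ht) as Hs. rewrite pow_add in Hs.
    assert (0 < (/ 2) ^ n * (/ 2) ^ k) by (apply Rmult_lt_0_compat; apply pow_lt; lra).
    assert ((/ 2) ^ n * (/ 2) ^ k * exp (2 * L * Rabs t) <= (/ 2) ^ n * (/ 2) ^ k * E)
      by (apply Rmult_le_compat_l; lra).
    rewrite <- tech_pow_Rmult. lra.
Qed.

Definition picard_lim (t : R) : R := real (Lim_seq (fun n => picard_iter n t)).

Lemma picard_iter_limit t : Rabs t <= T ->
  is_lim_seq (fun n => picard_iter n t) (picard_lim t).
Proof.
  intros Ht. apply Lim_seq_correct', ex_lim_seq_cauchy_corr.
  intros eps.
  assert (Lm : is_lim_seq (fun n => 4 * E * (/ 2) ^ n) (Rbar_mult (4 * E) 0)).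
  { apply is_lim_seq_scal_l, half_pow_limit. }
  simpl in Lm. rewrite Rmult_0_r in Lm.
  apply is_lim_seq_spec in Lm. destruct (Lm eps) as [N HN].
  specialize (HN N (Nat.le_refl N)). rewrite Rminus_0_r in HN.
  apply Rabs_def2 in HN.
  exists N. intros n m Hn Hm.
  pose proof (picard_iter_diff N (n - N) t Ht) as Hn'.
  pose proof (picard_iter_diff N (m - N) t Ht) as Hm'.
  replace (N + (n - N))%nat with n in Hn' by lia.
  replace (N + (m - N))%nat with m in Hm' by lia.
  replace (picard_iter n t - picard_iter m t) with
    ((picard_iter n t - picard_iter N t) - (picard_iter m t - picard_iter N t)) by ring.
  apply Rle_lt_trans with (1 := Rabs_triang _ _). rewrite Rabs_Ropp. lra.
Qed.

Lemma picard_lim_dist n t : Rabs t <= T ->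
  Rabs (picard_lim t - picard_iter n t) <= 2 * (/ 2) ^ n * E.
Proof.
  intros Ht.
  apply (is_lim_seq_le (fun k => Rabs (picard_iter (n + k) t - picard_iter n t))
    (fun _ => 2 * (/ 2) ^ n * E) (Rabs (picard_lim t - picard_iter n t)) (2 * (/ 2) ^ n * E)).
  - intros k. now apply picard_iter_diff.
  - apply (is_lim_seq_abs _ (Finite (picard_lim t - picard_iter n t))). apply is_lim_seq_minus'; [|apply is_lim_seq_const].
    apply is_lim_seq_ext with (fun k => picard_iter (k + n) t).
    + intros k. now rewrite Nat.add_comm.
    + apply (is_lim_seq_incr_n (fun k => picard_iter k t)). now apply picard_iter_limit.
  - apply is_lim_seq_const.
Qed.

(** From the first one on, the iterates have derivative bounded by [L], and this Lipschitz constant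
    survives the pointwise limit. *)
Lemma picard_lim_lipschitz s t : Rabs s <= T -> Rabs t <= T ->
  Rabs (picard_lim t - picard_lim s) <= L * Rabs (t - s).
Proof.
  intros Hs Ht.
  apply (is_lim_seq_le (fun n => Rabs (picard_iter (S n) t - picard_iter (S n) s))
    (fun _ => L * Rabs (t - s)) (Rabs (picard_lim t - picard_lim s)) (L * Rabs (t - s))).
  - intros n.
    destruct (mean_value _ _ s t (is_derive_picard_iter n)) as [c [Hc ->]].
    rewrite Rabs_mult. apply Rmult_le_compat_r; [apply Rabs_pos|].
    apply (HT c _ 0). revert Hc.
    apply Rabs_le_between in Hs. apply Rabs_le_between in Ht.
    unfold Rmin, Rmax. destruct (Rle_dec s t); intros Hc; apply Rabs_le; lra.
  - apply (is_lim_seq_abs _ (Finite (picard_lim t - picard_lim s))).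
    apply is_lim_seq_minus';
    apply (is_lim_seq_incr_1 (fun n => picard_iter n _)); now apply picard_iter_limit.
  - apply is_lim_seq_const.
Qed.
End Picard.

(** The iterates are defined on the whole line and their limit does not mention [T], so the solution
    is global at once and no local pieces have to be glued. The constants for each [T] only serve to
    estimate it on bounded time intervals. *)
Lemma picard (f : R -> R -> R) (y0 : R) : cont2 f ->
  (forall T, exists L, 0 < L /\ forall t x y, Rabs t <= T ->
    Rabs (f t x) <= L /\ Rabs (f t x - f t y) <= L * Rabs (x - y)) ->
  exists y : R -> R, y 0 = y0 /\ forall t, is_derive y t (f t (y t)).
Proof.
  intros Hf HL. set (y := picard_lim f y0).
  assert (Hy : forall t, continuous y t).
  { intros t. destruct (HL (Rabs t + 1)) as (L & Lpos & HT).
    apply filterlim_locally. intros eps.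
    (* The bound 1 keeps [s] inside [|s| <= |t| + 1], where [L] is valid. *)
    assert (P : 0 < Rmin 1 (eps / L)).
    { apply Rmin_glb_lt; [lra|]. apply Rdiv_lt_0_compat; [apply cond_pos|exact Lpos]. }
    exists (mkposreal _ P). intros s Hs. change (Rabs (s - t) < Rmin 1 (eps / L)) in Hs.
    change (Rabs (y s - y t) < eps).
    pose proof (Rmin_l 1 (eps / L)). pose proof (Rmin_r 1 (eps / L)).
    apply Rle_lt_trans with (L * Rabs (s - t)).
    - apply (picard_lim_lipschitz f y0 Hf _ L Lpos HT); [lra|].
      pose proof (Rabs_triang_inv s t). lra.
    - apply Rlt_le_trans with (L * (eps / L)).
      + apply Rmult_lt_compat_l; lra.
      + right. field. lra. }
  assert (Hi : forall t, y t = y0 + RInt (fun s => f s (y s)) 0 t).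
  { intros t. destruct (HL (Rabs t)) as (L & Lpos & HT).
    set (E := exp (2 * L * Rabs t)).
    (* Both sides are compared with iterate [S n]: its distance to [y t] costs [E], and integrating
       the Lipschitz bound between [y] and iterate [n] costs [2 * E * L * |t|], each times
       [(/ 2) ^ n]. *)
    apply eq_of_half_pow_bound with (E + 2 * E * L * Rabs t). intros n.
    pose proof (picard_lim_dist f y0 Hf _ L Lpos HT) as Hd. fold y E in Hd.
    pose proof (picard_iter_cts f y0 Hf n) as Hc.
    assert (Hc1 : forall s, continuous (fun s => f s (picard_iter f y0 n s)) s) by (intros s; cts).
    assert (Hc2 : forall s, continuous (fun s => f s (y s)) s) by (intros s; cts).
    replace (y t - (y0 + RInt (fun s => f s (y s)) 0 t)) with
      ((y t - picard_iter f y0 (S n) t) + RInt (fun s => f s (picard_iter f y0 n s) - f s (y s)) 0 t).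
    2:{ rewrite (RInt_minus_cts (fun s => f s (picard_iter f y0 n s)) (fun s => f s (y s))) by assumption.
        simpl. ring. }
    apply Rle_trans with (1 := Rabs_triang _ _).
    pose proof (Hd (S n) t (Rle_refl _)) as H1. rewrite <- tech_pow_Rmult in H1.
    assert (H2 : Rabs (RInt (fun s => f s (picard_iter f y0 n s) - f s (y s)) 0 t)
      <= RInt (fun _ => L * (2 * (/ 2) ^ n * E)) 0 (Rabs t)).
    { apply abs_RInt_le_abs; [intros s; cts|intros s; apply cts_const|]. 
      intros s Hs. apply Rle_trans with (1 := proj2 (HT s _ _ Hs)).
      apply Rmult_le_compat_l; [lra|]. rewrite Rabs_minus_sym. now apply Hd. }
    rewrite RInt_const_R in H2.
    lra. }
  exists y. split.
  - rewrite Hi, RInt_point. apply Rplus_0_r.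
  - intros t. apply is_derive_ext with (fun t => y0 + RInt (fun s => f s (y s)) 0 t).
    { intros s. symmetry. apply Hi. }
    rewrite <- (Rplus_0_l (f t (y t))).
    apply (is_derive_plus (K := R_AbsRing) (V := R_NormedModule) (fun _ => y0)).
    + apply (@is_derive_const R_AbsRing R_NormedModule).
    + apply (is_derive_RInt_cts (fun s => f s (y s))). intros s. cts.
Qed.


(** [E x * exp (- C * x)] does not increase. The derivative is asked only inside the interval, since
    the energy below is differentiable for positive times and merely continuous at time 0. *)
Lemma gronwall (E dE : R -> R) (C a b : R) : a <= b ->
  (forall x, continuous E x) ->
  (forall x, a < x < b -> is_derive E x (dE x)) ->
  (forall x, a < x < b -> dE x <= C * E x) ->
  E b <= E a * exp (C * (b - a)).
Proof.
  intros Hab Hc Hd HC.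
  pose (g := fun x => E x * exp (- C * x)).
  (* The mean value point may be returned as an end point, where no derivative is known. The value 0
     put there gives [g b = g a], which also suffices. *)
  destruct (MVT_gen g a b (fun x => if excluded_middle_informative (a < x < b)
    then dE x * exp (- C * x) + E x * (- C * exp (- C * x)) else 0)) as [c [_ Hc2]].
  - intros x Hx. rewrite Rmin_left, Rmax_right in Hx by exact Hab.
    destruct (excluded_middle_informative (a < x < b)) as [_|n]; [|contradiction].
    apply (is_derive_mult E (fun x => exp (- C * x)) x).
    + now apply Hd.
    + auto_derive; [trivial|ring].
    + apply Rmult_comm.
  - intros x _. apply continuity_pt_filterlim. apply (cts_mult E); [apply Hc|]. cts.
  - assert (Hg : g b <= g a).
    { apply Rminus_le. rewrite Hc2.
      destruct (excluded_middle_informative (a < c < b)) as [H|_]; [|lra].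
      specialize (HC c H).
      replace (dE c * exp (- C * c) + E c * (- C * exp (- C * c))) with
        (- ((C * E c - dE c) * exp (- C * c))) by ring.
      assert (0 <= (C * E c - dE c) * exp (- C * c) * (b - a)).
      { repeat apply Rmult_le_pos; try lra. left. apply exp_pos. }
      lra. }
    unfold g in Hg.
    replace (E b) with (E b * exp (- C * b) * exp (C * b)).
    2:{ rewrite Rmult_assoc, <- exp_plus. replace (- C * b + C * b) with 0 by ring.
        rewrite exp_0. ring. }
    replace (exp (C * (b - a))) with (exp (- C * a) * exp (C * b)).
    2:{ rewrite <- exp_plus. f_equal. ring. }
    rewrite <- Rmult_assoc. apply Rmult_le_compat_r; [left; apply exp_pos|exact Hg].
Qed.

(** The squared distance [E] to the equilibrium satisfies [|E'| <= 2 * L * E] and vanishes at [t1],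
    so Gronwall applies forwards, and backwards after reversing time. The backward direction shows
    that a trajectory starting elsewhere cannot reach an equilibrium in finite time. *)
Lemma autonomous_equilibrium (F y : R -> R) (L t1 : R) :
  (forall a b, Rabs (F a - F b) <= L * Rabs (a - b)) ->
  (forall t, is_derive y t (F (y t))) ->
  F (y t1) = 0 -> forall t, y t = y t1.
Proof.
  intros HF Hy H0 t.
  pose (E := fun s => (y s - y t1) ^ 2).
  pose (dE := fun s => 2 * (y s - y t1) * F (y s)).
  assert (Hyc : forall s, continuous y s) by (intros s; apply (is_derive_cts _ _ _ (Hy s))).
  assert (HE : forall s, is_derive E s (dE s)).
  { intros s. unfold dE. rewrite (Rmult_comm _ (F (y s))).
    apply (is_derive_comp (fun x => (x - y t1) ^ 2) y); [|apply Hy].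
    auto_derive; [trivial|ring]. }
  assert (Hb : forall s, Rabs (dE s) <= 2 * L * E s).
  { intros s. unfold dE, E. rewrite !Rabs_mult, (Rabs_pos_eq 2) by lra.
    specialize (HF (y s) (y t1)). rewrite H0, Rminus_0_r in HF.
    rewrite <- (pow2_abs (y s - y t1)).
    pose proof (Rabs_pos (y s - y t1)). nra. }
  assert (E0 : E t1 = 0) by (unfold E; ring).
  assert (Z : E t <= 0).
  { destruct (Rle_dec t1 t) as [Ht|Ht].
    - pose proof (gronwall E dE (2 * L) t1 t Ht) as G.
      rewrite E0, Rmult_0_l in G.
      apply G; intros x; [apply (is_derive_cts _ _ _ (HE x))|intros _; apply HE|].
      intros _. apply Rle_trans with (2 := Hb x), Rle_abs.
    - pose proof (gronwall (fun s => E (- s)) (fun s => - dE (- s)) (2 * L) (- t1) (- t)) as G.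
      cbv beta in G. rewrite !Ropp_involutive in G.
      rewrite E0, Rmult_0_l in G.
      assert (HE' : forall x, is_derive (fun s => E (- s)) x (- dE (- x))).
      { intros x. rewrite <- (Rmult_1_l (dE (- x))), Ropp_mult_distr_l.
        apply (is_derive_comp E (fun s => - s)); [apply HE|].
        auto_derive; [trivial|ring]. }
      apply G; [lra| | |].
      + intros x. apply (is_derive_cts _ _ _ (HE' x)).
      + intros x _. apply HE'.
      + intros x _. apply Rle_trans with (2 := Hb (- x)). rewrite <- Rabs_Ropp. apply Rle_abs. }
  unfold E in Z. apply Rminus_diag_uniq.
  pose proof (pow2_ge_0 (y t - y t1)). apply Rsqr_0_uniq. unfold Rsqr. lra.
Qed.

(** * Implicit functions *)

(* Caratheodory's formulation of differentiability. *)
Lemma is_derive_slope (g phi : R -> R) x :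
  continuous phi x -> (forall y, g y - g x = phi y * (y - x)) -> is_derive g x (phi x).
Proof.
  intros Hc H. apply is_derive_Reals. intros eps Heps.
  destruct (proj1 (filterlim_locally _ _) Hc (mkposreal eps Heps)) as [d Hd].
  exists d. intros h Hh Hhd.
  replace ((g (x + h) - g x) / h) with (phi (x + h)).
  - apply (Hd (x + h)). change (Rabs (x + h - x) < d). now rewrite Rplus_minus_l.
  - rewrite H, Rplus_minus_l. now field.
Qed.

Lemma slope_of_derive (g : R -> R) x l : is_derive g x l ->
  exists phi : R -> R, continuous phi x /\ phi x = l /\
    forall y, g y - g x = phi y * (y - x).
Proof.
  intros H. apply is_derive_Reals in H.
  exists (fun y => if Req_dec_T y x then l else (g y - g x) / (y - x)).
  split; [|split].
  - apply filterlim_locally. intros eps.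
    destruct (H eps (cond_pos eps)) as [d Hd]. exists d. intros y Hy.
    change (Rabs (y - x) < d) in Hy.
    destruct (Req_dec_T x x) as [_|n]; [|now destruct n].
    destruct (Req_dec_T y x) as [E|n]; [apply ball_center|].
    specialize (Hd (y - x)). rewrite Rplus_minus in Hd.
    apply Hd; [now apply Rminus_eq_contra|exact Hy].
  - destruct (Req_dec_T x x) as [_|n]; [reflexivity|now destruct n].
  - intros y. destruct (Req_dec_T y x) as [->|n]; [ring|].
    field. now apply Rminus_eq_contra.
Qed.

(** [xi s] is the mean value point between [B s0] and [B s]. It is picked by choice, but being
    trapped between these two values it is continuous at [s0]. Thus a jointly continuous partial
    derivative replaces total differentiability. *)
Lemma partial_slope (f J : R -> R -> R) (B : R -> R) s0 :
  (forall x s, is_derive (fun y => f y s) x (J x s)) -> cont2 J -> continuous B s0 ->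
  exists xi : R -> R, continuous xi s0 /\ xi s0 = B s0 /\
    forall s, f (B s) s - f (B s0) s = J (xi s) s * (B s - B s0).
Proof.
  intros Hf HJ HB.
  assert (Hxi : forall s, exists c, Rabs (c - B s0) <= Rabs (B s - B s0) /\
    f (B s) s - f (B s0) s = J c s * (B s - B s0)).
  { intros s. destruct (mean_value (fun y => f y s) (fun y => J y s) (B s0) (B s)) as [c [H1 H2]].
    - intros x; apply Hf.
    - exists c. split; [now apply abs_between|exact H2]. }
  pose (xi := fun s => proj1_sig (constructive_indefinite_description _ (Hxi s))).
  assert (Hxi1 : forall s, Rabs (xi s - B s0) <= Rabs (B s - B s0)).
  { intros s. exact (proj1 (proj2_sig (constructive_indefinite_description _ (Hxi s)))). }
  assert (E0 : xi s0 = B s0).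
  { specialize (Hxi1 s0). rewrite Rminus_diag, Rabs_R0 in Hxi1.
    apply Rminus_diag_uniq. destruct (Req_dec (xi s0 - B s0) 0) as [Z|Z]; [exact Z|].
    apply Rabs_pos_lt in Z. lra. }
  exists xi. split; [|split; [exact E0|]].
  - apply filterlim_locally. intros eps.
    apply (filter_imp (F := locally s0)) with (2 := proj1 (filterlim_locally _ _) HB eps).
    intros s Hb. change (Rabs (B s - B s0) < eps) in Hb.
    change (Rabs (xi s - xi s0) < eps). rewrite E0. specialize (Hxi1 s). lra.
  - intros s. exact (proj2 (proj2_sig (constructive_indefinite_description _ (Hxi s)))).
Qed.

(** On the level curve, [J (xi s) s * (B s - B s0) + phi s * (s - s0) = 0], with [phi] the slope of
    [f (B s0)] at [s0]. So [- phi / J] is a slope function for [B], continuous at [s0]. *)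
Lemma is_derive_implicit (f J : R -> R -> R) (B : R -> R) s0 l :
  (forall x s, is_derive (fun y => f y s) x (J x s)) ->
  cont2 J -> (forall x s, 0 < J x s) ->
  continuous B s0 -> (forall s, f (B s) s = f (B s0) s0) ->
  is_derive (f (B s0)) s0 l ->
  is_derive B s0 (- l / J (B s0) s0).
Proof.
  intros Hf HJ Jpos HB H0 Hl.
  destruct (slope_of_derive _ _ _ Hl) as (phi & Hphi & <- & Hs).
  destruct (partial_slope f J B s0 Hf HJ HB) as (xi & Cxi & E0 & Hxi).
  rewrite <- E0. apply (is_derive_slope B (fun s => - phi s / J (xi s) s)).
  - pose proof (Jpos (xi s0) s0). cts; [lra|exact Hphi|exact Cxi].
  - intros s. specialize (Hxi s). specialize (Hs s). rewrite H0 in Hxi.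
    pose proof (Jpos (xi s) s).
    apply Rmult_eq_reg_l with (J (xi s) s); [|lra].
    rewrite <- Hxi. transitivity (- (phi s * (s - s0))); [rewrite <- Hs; ring|field; lra].
Qed.

Lemma is_derive_along (f J : R -> R -> R) (B : R -> R) s0 b l :
  (forall x s, is_derive (fun y => f y s) x (J x s)) -> cont2 J ->
  is_derive B s0 b -> is_derive (f (B s0)) s0 l ->
  is_derive (fun s => f (B s) s) s0 (J (B s0) s0 * b + l).
Proof.
  intros Hf HJ Hb Hl.
  destruct (slope_of_derive _ _ _ Hl) as (phi & Hphi & <- & Hs).
  destruct (slope_of_derive _ _ _ Hb) as (beta & Hbeta & <- & Hs').
  destruct (partial_slope f J B s0 Hf HJ (is_derive_cts _ _ _ Hb)) as (xi & Cxi & E0 & Hxi).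
  rewrite <- E0.
  apply (is_derive_slope (fun s => f (B s) s) (fun s => J (xi s) s * beta s + phi s)).
  - cts; [exact Cxi|exact Hbeta|exact Hphi].
  - intros s. specialize (Hxi s). specialize (Hs s). specialize (Hs' s).
    replace (f (B s) s - f (B s0) s0) with
      ((f (B s) s - f (B s0) s) + (f (B s0) s - f (B s0) s0)) by ring.
    rewrite Hxi, Hs, Hs'. ring.
Qed.

(** Monotonicity puts [A z t] between [x0 - eps] and [x0 + eps] as soon as [z] lies strictly between
    the values of [Z] at these two labels, and that is an open condition on (z,t). *)
Lemma cont2_inverse (Z A : R -> R -> R) : cont2 Z ->
  (forall x y t, x < y -> Z x t < Z y t) ->
  (forall z t, Z (A z t) t = z) -> cont2 A.
Proof.
  intros HZ Hinc HA [z0 t0]. apply filterlim_locally. intros eps.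
  set (x0 := A z0 t0).
  assert (P1 : Z (x0 - eps) t0 < z0).
  { rewrite <- (HA z0 t0). apply Hinc. fold x0. pose proof (cond_pos eps). lra. }
  assert (P2 : z0 < Z (x0 + eps) t0).
  { rewrite <- (HA z0 t0). apply Hinc. fold x0. pose proof (cond_pos eps). lra. }
  assert (Q1 : 0 < (z0 - Z (x0 - eps) t0) / 2) by lra.
  assert (Q2 : 0 < (Z (x0 + eps) t0 - z0) / 2) by lra.
  destruct (proj1 (filterlim_locally _ _) (cont2_r Z (x0 - eps) HZ t0) (mkposreal _ Q1)) as [d1 H1].
  destruct (proj1 (filterlim_locally _ _) (cont2_r Z (x0 + eps) HZ t0) (mkposreal _ Q2)) as [d2 H2].
  assert (Q3 : 0 < Rmin (Rmin d1 d2) (Rmin ((z0 - Z (x0 - eps) t0) / 2) ((Z (x0 + eps) t0 - z0) / 2))).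
  { repeat apply Rmin_glb_lt; try assumption; apply cond_pos. }
  exists (mkposreal _ Q3). intros [z t] [Hz Ht]. cbn [fst snd] in *.
  change (Rabs (z - z0) < Rmin (Rmin d1 d2) (Rmin ((z0 - Z (x0 - eps) t0) / 2) ((Z (x0 + eps) t0 - z0) / 2))) in Hz.
  change (Rabs (t - t0) < Rmin (Rmin d1 d2) (Rmin ((z0 - Z (x0 - eps) t0) / 2) ((Z (x0 + eps) t0 - z0) / 2))) in Ht.
  change (Rabs (A z t - x0) < eps).
  pose proof (Rmin_l (Rmin d1 d2) (Rmin ((z0 - Z (x0 - eps) t0) / 2) ((Z (x0 + eps) t0 - z0) / 2))).
  pose proof (Rmin_r (Rmin d1 d2) (Rmin ((z0 - Z (x0 - eps) t0) / 2) ((Z (x0 + eps) t0 - z0) / 2))).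
  pose proof (Rmin_l d1 d2). pose proof (Rmin_r d1 d2).
  pose proof (Rmin_l ((z0 - Z (x0 - eps) t0) / 2) ((Z (x0 + eps) t0 - z0) / 2)).
  pose proof (Rmin_r ((z0 - Z (x0 - eps) t0) / 2) ((Z (x0 + eps) t0 - z0) / 2)).
  assert (B1 : Rabs (Z (x0 - eps) t - Z (x0 - eps) t0) < (z0 - Z (x0 - eps) t0) / 2).
  { apply (H1 t). change (Rabs (t - t0) < d1). lra. }
  assert (B2 : Rabs (Z (x0 + eps) t - Z (x0 + eps) t0) < (Z (x0 + eps) t0 - z0) / 2).
  { apply (H2 t). change (Rabs (t - t0) < d2). lra. }
  apply Rabs_def2 in B1. apply Rabs_def2 in B2.
  assert (B3 : Rabs (z - z0) < (z0 - Z (x0 - eps) t0) / 2) by lra.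
  assert (B4 : Rabs (z - z0) < (Z (x0 + eps) t0 - z0) / 2) by lra.
  apply Rabs_def2 in B3. apply Rabs_def2 in B4.
  assert (mono : forall x y, Z x t < Z y t -> x < y).
  { intros x y Hxy. destruct (Rtotal_order x y) as [L|[L|L]]; [exact L|subst; lra|].
    apply (Hinc _ _ t) in L. lra. }
  apply Rabs_def1.
  - cut (A z t < x0 + eps); [lra|]. apply mono. rewrite HA. lra.
  - cut (x0 - eps < A z t); [lra|]. apply mono. rewrite HA. lra.
Qed.


(** * Half-plane derivatives, periodic functions and smoothness classes *)

Lemma is_derive_t_of_is_derive (f : R -> R) t l :
  0 <= t -> is_derive f t l -> is_derive_t f t l.
Proof.
  intros Ht Hd.
  assert (PF : ProperFilter (within (fun s : R => 0 <= s) (locally t))).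
  { split; [|apply within_filter, locally_filter].
    intros P HP. exists t. exact (locally_singleton _ _ HP Ht). }
  apply (filterdiff_locally f t); [|exact Hd].
  intros P HP. unfold within. apply (filter_imp (F := locally t)) with (2 := HP). tauto.
Qed.

Lemma is_derive_of_is_derive_t (f : R -> R) t l :
  0 < t -> is_derive_t f t l -> is_derive f t l.
Proof.
  intros Ht [Hl Hd]. split; [exact Hl|].
  intros x Hx eps.
  assert (Hpos : locally t (fun s : R => 0 <= s)).
  { apply (filter_imp (F := locally t)) with (fun s => 0 < s); [intros; lra|].
    exact (open_gt 0 t Ht). }
  assert (Hx' : is_filter_lim (within (fun s : R => 0 <= s) (locally t)) x).
  { intros P HP. unfold within. apply (filter_imp (F := locally t)) with (2 := Hx P HP). tauto. }
  pose proof (Hd x Hx' eps) as Hw. unfold within in Hw.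
  apply (filter_imp (F := locally t)) with (2 := filter_and (F := locally t) _ _ Hw Hpos).
  intros y [H1 H2]. now apply H1.
Qed.

Lemma continuous_half_plane_of_cont2 (f : R -> R -> R) : cont2 f -> continuous_half_plane f.
Proof.
  intros Hf p _. apply filterlim_filter_le_1 with (2 := Hf p).
  intros P HP. unfold within. apply (filter_imp (F := locally p)) with (2 := HP). tauto.
Qed.

Lemma Rmax_0_ball t s (eps : posreal) : Rabs (s - t) < eps -> Rabs (Rmax 0 s - Rmax 0 t) < eps.
Proof.
  intros H. apply Rabs_def2 in H. apply Rabs_def1;
  unfold Rmax; destruct (Rle_dec 0 s), (Rle_dec 0 t); destruct eps; simpl in *; lra.
Qed.

(** [Rmax 0] is a 1-Lipschitz retraction of the line onto the half-line, so relative continuity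
    becomes continuity on the plane. *)
Lemma cont2_of_continuous_half_plane (f : R -> R -> R) :
  continuous_half_plane f -> cont2 (fun z t => f z (Rmax 0 t)).
Proof.
  intros Hf [z t].
  assert (H := Hf (z, Rmax 0 t) (Rmax_l 0 t)).
  apply filterlim_locally. intros eps.
  destruct (proj1 (filterlim_locally _ _) H eps) as [d Hd].
  exists d. intros [z' t'] [Hz Ht].
  apply (Hd (z', Rmax 0 t')); [|apply Rmax_l].
  split; [exact Hz|]. now apply (Rmax_0_ball t t').
Qed.

Lemma continuous_of_continuous_on (a : R -> R) :
  continuous_on (fun t : R => 0 <= t) a -> forall t, continuous (fun t => a (Rmax 0 t)) t.
Proof.
  intros Ha t. assert (H := Ha (Rmax 0 t) (Rmax_l 0 t)).
  apply filterlim_locally. intros eps.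
  destruct (proj1 (filterlim_locally _ _) H eps) as [d Hd].
  exists d. intros t' Ht.
  apply (Hd (Rmax 0 t')); [|apply Rmax_l]. now apply (Rmax_0_ball t t').
Qed.

Lemma periodic1_nat f n : periodic1 f -> forall z, f (z + INR n) = f z.
Proof.
  intros Hf. induction n as [|n IH]; intros z; [now rewrite Rplus_0_r|].
  rewrite S_INR, <- Rplus_assoc, Hf. apply IH.
Qed.

Lemma periodic1_IZR f k : periodic1 f -> forall z, f (z + IZR k) = f z.
Proof.
  intros Hf z. destruct (Z.le_gt_cases 0 k) as [Hk|Hk].
  - rewrite <- (Z2Nat.id k Hk), <- INR_IZR_INZ. now apply periodic1_nat.
  - rewrite <- (periodic1_nat f (Z.to_nat (- k)) Hf (z + IZR k)).
    rewrite INR_IZR_INZ, Z2Nat.id by lia. f_equal. rewrite opp_IZR. ring.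
Qed.

Lemma periodic1_bounded f : periodic1 f -> (forall x, continuous f x) ->
  exists M, 0 <= M /\ forall x, Rabs (f x) <= M.
Proof.
  intros Hp Hc.
  destruct (bounded_continuity f 0 1) as [M HM]; [intros; apply Hc|].
  assert (HM' : forall x, 0 <= x <= 1 -> Rabs (f x) <= M) by (intros x Hx; left; exact (HM x Hx)).
  exists M. split.
  - apply Rle_trans with (1 := Rabs_pos (f 0)). apply HM'. lra.
  - intros x. rewrite <- (periodic1_IZR f (- Int_part x) Hp x).
    apply HM'. rewrite opp_IZR. pose proof (base_Int_part x). lra.
Qed.

Lemma RInt_periodic1 f a : periodic1 f -> (forall x, continuous f x) ->
  RInt f a (a + 1) = RInt f 0 1.
Proof.
  intros Hp Hc.
  assert (E : RInt f 1 (a + 1) = RInt f 0 a).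
  { transitivity (RInt f (1 * 0 + 1) (1 * a + 1)); [f_equal; ring|].
    rewrite <- (RInt_comp_lin f) by now apply ex_RInt_cts.
    apply RInt_ext. intros x _. change (1 * f (1 * x + 1) = f x).
    now rewrite !Rmult_1_l, Hp. }
  rewrite <- (RInt_Chasles_cts f a 1 (a + 1)), E by exact Hc.
  rewrite <- (RInt_Chasles_cts f 0 a 1) by exact Hc. apply Rplus_comm.
Qed.

Lemma periodic1_derive (f df : R -> R) :
  (forall x, is_derive f x (df x)) -> periodic1 f -> periodic1 df.
Proof.
  intros Hd Hp x.
  rewrite <- (is_derive_unique f x (df x) (Hd x)). symmetry. apply is_derive_unique.
  apply is_derive_ext with (fun y => f (y + 1)); [exact Hp|].
  rewrite <- (Rmult_1_l (df (x + 1))).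
  apply (is_derive_comp f (fun y => y + 1)); [apply Hd|].
  auto_derive; [trivial|ring].
Qed.

(** A recursive form of [Cm]. Closure under products, inverses and composition follows by induction
    on [n], without any formula for higher derivatives. *)
Fixpoint class_C (n : nat) (f : R -> R) : Prop :=
  match n with
  | O => forall x, continuous f x
  | S n => exists g : R -> R, (forall x, is_derive f x (g x)) /\ class_C n g
  end.

Lemma Derive_n_S_of_derive (f g : R -> R) : (forall x, is_derive f x (g x)) ->
  forall k x, Derive_n f (S k) x = Derive_n g k x.
Proof.
  intros H k. induction k as [|k IH]; intros x.
  - apply is_derive_unique, H.
  - change (Derive (Derive_n f (S k)) x = Derive (Derive_n g k) x).
    now apply Derive_ext.
Qed.

Lemma class_C_of_Cm n f : Cm n f -> class_C n f.
Proof.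
  revert f. induction n as [|n IH]; intros f H.
  - intros x. exact (proj2 (H 0%nat (Nat.le_refl _) x)).
  - assert (Hd : forall x, is_derive f x (Derive f x)).
    { intros x. apply Derive_correct. apply (H 1%nat). lia. }
    exists (Derive f). split; [exact Hd|].
    apply IH. intros k Hk z. split.
    + destruct k as [|k]; [exact I|].
      apply ex_derive_ext with (Derive_n f (S k)).
      { intros x. now apply Derive_n_S_of_derive. }
      apply (H (S (S k))). lia.
    + apply continuous_ext with (Derive_n f (S k)).
      { intros x. now apply Derive_n_S_of_derive. }
      apply (H (S k)). lia.
Qed.

Lemma class_C_cts n f : class_C n f -> forall x, continuous f x.
Proof.
  destruct n as [|n]; [trivial|]. intros [g [H _]] x. exact (is_derive_cts _ _ _ (H x)).
Qed.

Lemma Cm_of_class_C n f : class_C n f -> Cm n f.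
Proof.
  revert f. induction n as [|n IH]; intros f H k Hk z.
  - replace k with 0%nat by lia. split; [exact I|apply H].
  - pose proof (class_C_cts _ _ H) as Hc.
    destruct H as [g [Hg Hn]]. apply IH in Hn.
    destruct k as [|k]; [split; [exact I|apply Hc]|].
    pose proof (Derive_n_S_of_derive f g Hg) as E.
    split.
    + destruct k as [|k]; [now exists (g z)|].
      apply ex_derive_ext with (Derive_n g k); [intros x; now rewrite E|].
      apply (Hn (S k)). lia.
    + apply continuous_ext with (Derive_n g k); [intros x; now rewrite E|].
      apply (Hn k). lia.
Qed.

Lemma class_C_ext n f g : (forall x, f x = g x) -> class_C n f -> class_C n g.
Proof.
  intros E. destruct n as [|n].
  - intros H x. apply continuous_ext with f; [exact E|apply H].
  - intros [h [Hh Hn]]. exists h. split; [|exact Hn].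
    intros x. apply is_derive_ext with f; [exact E|apply Hh].
Qed.

Lemma class_C_S n f : class_C (S n) f -> class_C n f.
Proof.
  revert f. induction n as [|n IH]; intros f H; [exact (class_C_cts _ _ H)|].
  destruct H as [g [Hg Hn]]. exists g. split; [exact Hg|now apply IH].
Qed.

Lemma class_C_const n c : class_C n (fun _ => c).
Proof.
  revert c. induction n as [|n IH]; intros c; [intros x; apply cts_const|].
  exists (fun _ => 0). split; [|apply IH]. intros x.
  apply (@is_derive_const R_AbsRing R_NormedModule).
Qed.

Lemma class_C_plus n f g : class_C n f -> class_C n g -> class_C n (fun x => f x + g x).
Proof.
  revert f g. induction n as [|n IH]; intros f g Hf Hg; [intros x; now apply cts_plus|].
  destruct Hf as [f' [Hf Hnf]], Hg as [g' [Hg Hng]].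
  exists (fun x => f' x + g' x). split; [|now apply IH].
  intros x. now apply (is_derive_plus f g).
Qed.

Lemma class_C_mult n f g : class_C n f -> class_C n g -> class_C n (fun x => f x * g x).
Proof.
  revert f g. induction n as [|n IH]; intros f g Hf Hg; [intros x; now apply cts_mult|].
  pose proof (class_C_S _ _ Hf). pose proof (class_C_S _ _ Hg).
  destruct Hf as [f' [Hf Hnf]], Hg as [g' [Hg Hng]].
  exists (fun x => f' x * g x + f x * g' x).
  split; [|apply class_C_plus; now apply IH].
  intros x. apply (is_derive_mult f g); [apply Hf|apply Hg|exact Rmult_comm].
Qed.

Lemma class_C_opp n f : class_C n f -> class_C n (fun x => - f x).
Proof.
  intros H. apply class_C_ext with (fun x => -1 * f x); [intros; ring|].
  apply class_C_mult; [apply class_C_const|exact H].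
Qed.

Lemma class_C_minus n f g : class_C n f -> class_C n g -> class_C n (fun x => f x - g x).
Proof. intros Hf Hg. apply class_C_plus; [exact Hf|now apply class_C_opp]. Qed.

Lemma class_C_pow n f k : class_C n f -> class_C n (fun x => f x ^ k).
Proof.
  intros H. induction k as [|k IH]; simpl; [apply class_C_const|now apply class_C_mult].
Qed.

Lemma class_C_inv n f : (forall x, f x <> 0) -> class_C n f -> class_C n (fun x => / f x).
Proof.
  intros H0. induction n as [|n IH]; intros Hf; [intros x; now apply cts_inv|].
  assert (Hi : class_C n (fun x => / f x)) by (apply IH; now apply class_C_S).
  destruct Hf as [f' [Hf Hnf]].
  (* The derivative is written through [/ f] itself, so that the induction hypothesis covers it. *)
  exists (fun x => - f' x * (/ f x * / f x)). split.
  - intros x. replace (- f' x * (/ f x * / f x)) with (- f' x / f x ^ 2) by (field; apply H0).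
    now apply is_derive_inv.
  - apply class_C_mult; [now apply class_C_opp|now apply class_C_mult].
Qed.

Lemma class_C_comp n f g : class_C n f -> class_C n g -> class_C n (fun x => f (g x)).
Proof.
  revert f. induction n as [|n IH]; intros f Hf Hg; [intros x; now apply (cts_comp f g)|].
  pose proof (class_C_S _ _ Hg) as Hg1.
  destruct Hf as [f' [Hf Hnf]], Hg as [g' [Hg Hng]].
  exists (fun x => g' x * f' (g x)). split.
  - intros x. apply (is_derive_comp f g); [apply Hf|apply Hg].
  - apply class_C_mult; [exact Hng|now apply IH].
Qed.


(** * The angle equation *)

(** It takes the values of the data, not the data and a label, so that one formula serves at a label
    [x] and at a position [z] through [A z t]. *)
Definition K0 (u v th : R) : R := (cos th + v * sin th) ^ 2 + (u * sin th) ^ 2.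

Lemma Rabs_sin_le x : Rabs (sin x) <= 1.
Proof. apply Rabs_le. pose proof (SIN_bound x). lra. Qed.

Lemma Rabs_cos_le x : Rabs (cos x) <= 1.
Proof. apply Rabs_le. pose proof (COS_bound x). lra. Qed.

Lemma sin_lipschitz x y : Rabs (sin x - sin y) <= Rabs (x - y).
Proof.
  destruct (mean_value sin cos y x) as [c [_ ->]].
  - intros z. apply is_derive_sin.
  - rewrite Rabs_mult. rewrite <- Rmult_1_l.
    apply Rmult_le_compat_r; [apply Rabs_pos|apply Rabs_cos_le].
Qed.

Lemma cos_lipschitz x y : Rabs (cos x - cos y) <= Rabs (x - y).
Proof.
  destruct (mean_value cos (fun z => - sin z) y x) as [c [_ ->]].
  - intros z. apply is_derive_cos.
  - rewrite Rabs_mult, Rabs_Ropp. rewrite <- Rmult_1_l.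
    apply Rmult_le_compat_r; [apply Rabs_pos|apply Rabs_sin_le].
Qed.

Lemma Rabs_mult_le a b c d : Rabs a <= c -> Rabs b <= d -> Rabs (a * b) <= c * d.
Proof.
  intros. rewrite Rabs_mult. apply Rmult_le_compat; try apply Rabs_pos; assumption.
Qed.

Section Angle.
Context (u0 v0 : R -> R) (M N : R).
Context (Hu : forall x, Rabs (u0 x) <= M) (Hv : forall x, Rabs (v0 x) <= M).
Context (HN : 0 <= N).
Context (Lu : forall x y, Rabs (u0 x - u0 y) <= N * Rabs (x - y)).
Context (Lv : forall x y, Rabs (v0 x - v0 y) <= N * Rabs (x - y)).
Context (Cu : forall x, continuous u0 x) (Cv : forall x, continuous v0 x).
Context (pu : periodic1 u0) (pv : periodic1 v0).

Let p x th := cos th + v0 x * sin th.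
Let q x th := u0 x * sin th.
(** A substitute for [sqrt K], comparable to it up to the factor sqrt 2. Its Lipschitz bounds in
    label and angle need only the triangle inequality and avoid the square root near 0. *)
Let nn x th := Rabs (p x th) + Rabs (q x th).
Let K x th := K0 (u0 x) (v0 x) th.
(** It bounds [nn] and is also the Lipschitz constant of [nn] in the angle: [1 + M] from [p] and [M]
    from [q]. *)
Let B := 1 + 2 * M.
Let C1 := 4 * (2 * N + B).

Local Lemma M_ge0 : 0 <= M.
Proof. apply Rle_trans with (1 := Rabs_pos (u0 0)). apply Hu. Qed.

Local Lemma nn_ge0 x th : 0 <= nn x th.
Proof. unfold nn. pose proof (Rabs_pos (p x th)). pose proof (Rabs_pos (q x th)). lra. Qed.

Local Lemma nn_le x th : nn x th <= B.
Proof.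
  unfold nn, p, q, B.
  pose proof (Rabs_triang (cos th) (v0 x * sin th)).
  pose proof (Rabs_cos_le th).
  pose proof (Rabs_mult_le _ _ _ _ (Hv x) (Rabs_sin_le th)).
  pose proof (Rabs_mult_le _ _ _ _ (Hu x) (Rabs_sin_le th)). lra.
Qed.

Local Lemma nn_le_shift x y th : nn x th <= nn y th + 2 * N * Rabs (x - y).
Proof.
  unfold nn.
  assert (H1 : Rabs (p x th - p y th) <= N * Rabs (x - y) * 1).
  { unfold p. replace (cos th + v0 x * sin th - (cos th + v0 y * sin th)) with ((v0 x - v0 y) * sin th) by ring.
    apply Rabs_mult_le; [apply Lv|apply Rabs_sin_le]. }
  assert (H2 : Rabs (q x th - q y th) <= N * Rabs (x - y) * 1).
  { unfold q. rewrite <- Rmult_minus_distr_r.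
    apply Rabs_mult_le; [apply Lu|apply Rabs_sin_le]. }
  pose proof (Rabs_triang_inv (p x th) (p y th)).
  pose proof (Rabs_triang_inv (q x th) (q y th)). lra.
Qed.

Local Lemma p_lip x th th' : Rabs (p x th - p x th') <= (1 + M) * Rabs (th - th').
Proof.
  unfold p.
  replace (cos th + v0 x * sin th - (cos th' + v0 x * sin th')) with
    ((cos th - cos th') + v0 x * (sin th - sin th')) by ring.
  pose proof (Rabs_triang (cos th - cos th') (v0 x * (sin th - sin th'))).
  pose proof (cos_lipschitz th th').
  pose proof (Rabs_mult_le _ _ _ _ (Hv x) (sin_lipschitz th th')). lra.
Qed.

Local Lemma q_lip x th th' : Rabs (q x th - q x th') <= M * Rabs (th - th').
Proof.
  unfold q. rewrite <- Rmult_minus_distr_l. apply Rabs_mult_le; [apply Hu|apply sin_lipschitz].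
Qed.

Local Lemma nn_le_rot x th th' : nn x th <= nn x th' + B * Rabs (th - th').
Proof.
  unfold nn, B.
  pose proof (p_lip x th th'). pose proof (q_lip x th th').
  pose proof (Rabs_triang_inv (p x th) (p x th')).
  pose proof (Rabs_triang_inv (q x th) (q x th')). lra.
Qed.

Local Lemma K_nn x th : K x th <= nn x th ^ 2 /\ nn x th ^ 2 <= 2 * K x th.
Proof.
  unfold K, K0, nn. fold (p x th). fold (q x th).
  rewrite <- (pow2_abs (p x th)), <- (pow2_abs (q x th)).
  pose proof (Rabs_pos (p x th)). pose proof (Rabs_pos (q x th)).
  pose proof (pow2_ge_0 (Rabs (p x th) - Rabs (q x th))). split; nra.
Qed.

(** Factoring the differences of squares keeps a factor [nn], of the order of [sqrt K]. A plain
    Lipschitz bound would lose it, and it is what tames [1 / (K K')] in the estimate for [G]. *)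
Local Lemma K_diff x th th' :
  Rabs (K x th - K x th') <= B * Rabs (th - th') * (nn x th + nn x th').
Proof.
  unfold K, K0. fold (p x th) (q x th) (p x th') (q x th').
  replace (p x th ^ 2 + q x th ^ 2 - (p x th' ^ 2 + q x th' ^ 2)) with
    ((p x th - p x th') * (p x th + p x th') + (q x th - q x th') * (q x th + q x th')) by ring.
  apply Rle_trans with (1 := Rabs_triang _ _).
  pose proof (Rabs_mult_le _ _ _ _ (p_lip x th th') (Rabs_triang (p x th) (p x th'))).
  pose proof (Rabs_mult_le _ _ _ _ (q_lip x th th') (Rabs_triang (q x th) (q x th'))).
  unfold nn, B. pose proof M_ge0. pose proof (Rabs_pos (th - th')).
  assert (0 <= M * Rabs (th - th') * (Rabs (p x th) + Rabs (p x th'))).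
  { repeat apply Rmult_le_pos; try assumption.
    pose proof (Rabs_pos (p x th)). pose proof (Rabs_pos (p x th')). lra. }
  assert (0 <= (1 + M) * Rabs (th - th') * (Rabs (q x th) + Rabs (q x th'))).
  { repeat apply Rmult_le_pos; try lra.
    pose proof (Rabs_pos (q x th)). pose proof (Rabs_pos (q x th')). lra. }
  lra.
Qed.

Let D th := exists x, K x th = 0.
Let G th := RInt (fun x => / K x th) 0 1.

Local Lemma K_ge0 x th : 0 <= K x th.
Proof. unfold K, K0. apply Rplus_le_le_0_compat; apply pow2_ge_0. Qed.

Local Lemma K_pos x th : ~ D th -> 0 < K x th.
Proof.
  intros H. destruct (K_ge0 x th) as [L|L]; [exact L|].
  exfalso. apply H. now exists x.
Qed.

Local Lemma invK_cts th : ~ D th -> forall x, continuous (fun x => / K x th) x.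
Proof.
  intros H x. pose proof (K_pos x th H) as Hp. unfold K, K0 in *. cts. lra.
Qed.

(** Let n be the value of [nn] at [x]. On an interval of length [l = n / (2 * N + B)] to the right
    of [x], [nn] stays below 2n, hence [K <= 4 n^2]. This interval alone contributes [l / (4 n^2)],
    which is [1 / (C1 * n)], to the integral over one period. The summand [B] ensures [l <= 1], so
    the interval fits into the period. *)
Local Lemma G_ge x th : ~ D th -> / nn x th <= C1 * G th /\ 0 < nn x th.
Proof.
  intros H. set (n := nn x th).
  assert (B1 : 1 <= B) by (unfold B; pose proof M_ge0; lra).
  assert (np : 0 < n).
  { destruct (nn_ge0 x th) as [L|L]; [exact L|].
    pose proof (K_pos x th H). pose proof (K_nn x th) as [L' _].
    fold n in L, L'. rewrite <- L in L'. simpl in L'. lra. }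
  split; [|exact np].
  pose proof (nn_le x th) as nB. fold n in nB.
  set (S := 2 * N + B). assert (Sp : 0 < S) by (unfold S; lra).
  set (l := n / S).
  assert (l0 : 0 < l) by (apply Rdiv_lt_0_compat; assumption).
  assert (l1 : l <= 1).
  { apply Rmult_le_reg_r with S; [exact Sp|]. unfold l. field_simplify; [|lra]. unfold S. lra. }
  assert (E : G th = RInt (fun y => / K y th) x (x + l) + RInt (fun y => / K y th) (x + l) (x + 1)).
  { unfold G. rewrite <- (RInt_periodic1 (fun y => / K y th) x).
    - symmetry. apply RInt_Chasles_cts. now apply invK_cts.
    - intros y. unfold K. now rewrite pu, pv.
    - now apply invK_cts. }
  assert (E2 : 0 <= RInt (fun y => / K y th) (x + l) (x + 1)).
  { apply RInt_ge_0; [lra|apply ex_RInt_cts; now apply invK_cts|].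
    intros y _. left. apply Rinv_0_lt_compat. now apply K_pos. }
  assert (E1 : l * / (4 * n ^ 2) <= RInt (fun y => / K y th) x (x + l)).
  { replace (l * / (4 * n ^ 2)) with (RInt (fun _ => / (4 * n ^ 2)) x (x + l)).
    2:{ rewrite RInt_const_R, Rplus_minus_l. reflexivity. }
    apply RInt_le; [lra|apply ex_RInt_cts; intros; apply cts_const|apply ex_RInt_cts; now apply invK_cts|].
    intros y Hy. apply Rinv_le_contravar; [now apply K_pos|].
    apply Rle_trans with (1 := proj1 (K_nn y th)).
    pose proof (nn_le_shift y x th) as L. fold n in L.
    assert (L2 : 2 * N * Rabs (y - x) <= n).
    { rewrite Rabs_pos_eq by lra.
      apply Rle_trans with (2 * N * l); [apply Rmult_le_compat_l; lra|].
      replace n with (S * l) at 1 by (unfold l; field; lra).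
      apply Rmult_le_compat_r; [lra|]. unfold S. lra. }
    pose proof (nn_ge0 y th). replace (4 * n ^ 2) with ((2 * n) ^ 2) by ring.
    apply pow_incr. lra. }
  assert (E3 : / n = 4 * S * (l * / (4 * n ^ 2))).
  { unfold l. field. lra. }
  rewrite E3. unfold C1. fold S. apply Rmult_le_compat_l; lra.
Qed.

Local Lemma C1_pos : 0 < C1.
Proof. unfold C1, B. pose proof M_ge0. lra. Qed.

Local Lemma G_pos th : ~ D th -> 0 < G th.
Proof.
  intros H. destruct (G_ge 0 th H) as [H1 H2]. apply Rinv_0_lt_compat in H2.
  pose proof C1_pos. apply Rmult_lt_reg_l with C1; lra.
Qed.

(* [1 / G], extended by [0] across the angles at which [K] vanishes somewhere. *)
Let H th := if excluded_middle_informative (D th) then 0 else / G th.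

Local Lemma H_D th : D th -> H th = 0.
Proof. intros HD. unfold H. now destruct (excluded_middle_informative (D th)). Qed.

Local Lemma H_nD th : ~ D th -> H th = / G th.
Proof. intros HD. unfold H. now destruct (excluded_middle_informative (D th)). Qed.

Local Lemma H_ge0 th : 0 <= H th.
Proof.
  destruct (classic (D th)) as [HD|HD]; [rewrite H_D; [lra|exact HD]|].
  rewrite H_nD by exact HD. left. now apply Rinv_0_lt_compat, G_pos.
Qed.

Local Lemma H_le x th : H th <= C1 * nn x th.
Proof.
  destruct (classic (D th)) as [HD|HD].
  - rewrite H_D by exact HD. apply Rmult_le_pos; [left; apply C1_pos|apply nn_ge0].
  - rewrite H_nD by exact HD. destruct (G_ge x th HD) as [H1 H2].
    pose proof (G_pos th HD). apply Rmult_le_reg_l with (G th * / nn x th).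
    + apply Rmult_lt_0_compat; [assumption|now apply Rinv_0_lt_compat].
    + replace (G th * / nn x th * / G th) with (/ nn x th) by (field; lra).
      replace (G th * / nn x th * (C1 * nn x th)) with (C1 * G th) by (field; lra).
      exact H1.
Qed.

(** At a label where [K] vanishes for [th'], [nn] grows from 0 at rate at most [B], and
    [H <= C1 * nn] at that label. The factor 4 only matches the general estimate. *)
Local Lemma H_lip_D th th' : D th' -> Rabs (H th - H th') <= 4 * B * C1 * Rabs (th - th').
Proof.
  intros [x Hx]. rewrite (H_D th') by now exists x.
  rewrite Rminus_0_r, Rabs_pos_eq by apply H_ge0.
  apply Rle_trans with (1 := H_le x th).
  assert (Z : nn x th' = 0).
  { pose proof (proj2 (K_nn x th')) as L. rewrite Hx in L. pose proof (nn_ge0 x th'). nra. }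
  pose proof (nn_le_rot x th th') as L. rewrite Z in L.
  pose proof C1_pos. pose proof M_ge0. pose proof (Rabs_pos (th - th')).
  assert (0 <= C1 * (B * Rabs (th - th'))).
  { apply Rmult_le_pos; [lra|]. apply Rmult_le_pos; [unfold B|]; lra. }
  apply Rle_trans with (C1 * (0 + B * Rabs (th - th'))); [apply Rmult_le_compat_l; lra|lra].
Qed.

(** Away from the singular angles, [|1/K' - 1/K|] is at most [B * d * (nn + nn') / (K K')], and
    [nn / K <= 2 / nn <= 2 * C1 * G]. Integration turns the remaining [1/K'] and [1/K] into [G'] and
    [G], so the difference of the integrals is at most [4 * B * C1 * d * G * G']. Division by
    [G * G'] leaves a constant independent of how small [K] is. *)
Local Lemma H_lip th th' : Rabs (H th - H th') <= 4 * B * C1 * Rabs (th - th').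
Proof.
  destruct (classic (D th')) as [HD'|HD']; [now apply H_lip_D|].
  destruct (classic (D th)) as [HD|HD].
  { rewrite Rabs_minus_sym, (Rabs_minus_sym th). now apply H_lip_D. }
  rewrite !H_nD by assumption.
  pose proof (G_pos th HD) as P. pose proof (G_pos th' HD') as P'.
  set (d := Rabs (th - th')).
  pose proof C1_pos as PC. pose proof M_ge0 as PM.
  assert (PB : 0 < B) by (unfold B; lra).
  assert (Pd : 0 <= d) by apply Rabs_pos.
  assert (Cd : forall x, continuous (fun x => / K x th' - / K x th) x).
  { intros x. apply cts_minus; now apply invK_cts. }
  assert (pt : forall x, Rabs (/ K x th' - / K x th) <=
    2 * B * C1 * d * (G th * / K x th' + G th' * / K x th)).
  { intros x. pose proof (K_pos x th HD) as Q. pose proof (K_pos x th' HD') as Q'.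
    destruct (G_ge x th HD) as [g1 n1]. destruct (G_ge x th' HD') as [g2 n2].
    replace (/ K x th' - / K x th) with ((K x th - K x th') * (/ K x th * / K x th')) by (field; lra).
    apply Rinv_0_lt_compat in Q as I. apply Rinv_0_lt_compat in Q' as I'.
    rewrite Rabs_mult, (Rabs_pos_eq (/ K x th * / K x th')) by (apply Rmult_le_pos; lra).
    apply Rle_trans with (B * d * (nn x th + nn x th') * (/ K x th * / K x th')).
    { apply Rmult_le_compat_r; [apply Rmult_le_pos; lra|apply K_diff]. }
    assert (T : forall y, 0 < K x y -> 0 < nn x y -> / nn x y <= C1 * G y ->
      nn x y * / K x y <= 2 * C1 * G y).
    { intros y Hy Hn Hg. apply Rle_trans with (2 * / nn x y); [|lra].
      apply Rmult_le_reg_r with (K x y * nn x y); [now apply Rmult_lt_0_compat|].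
      pose proof (proj2 (K_nn x y)).
      replace (nn x y * / K x y * (K x y * nn x y)) with (nn x y ^ 2) by (field; lra).
      replace (2 * / nn x y * (K x y * nn x y)) with (2 * K x y) by (field; lra).
      assumption. }
    pose proof (T th Q n1 g1) as T1. pose proof (T th' Q' n2 g2) as T2.
    replace (B * d * (nn x th + nn x th') * (/ K x th * / K x th')) with
      (B * d * ((nn x th * / K x th) * / K x th' + (nn x th' * / K x th') * / K x th)) by ring.
    replace (2 * B * C1 * d * (G th * / K x th' + G th' * / K x th)) with
      (B * d * ((2 * C1 * G th) * / K x th' + (2 * C1 * G th') * / K x th)) by ring.
    apply Rmult_le_compat_l; [apply Rmult_le_pos; lra|].
    apply Rplus_le_compat; apply Rmult_le_compat_r; lra. }
  assert (I : Rabs (G th' - G th) <= 4 * B * C1 * d * (G th * G th')).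
  { unfold G at 1 2. rewrite <- RInt_minus_cts by now apply invK_cts.
    apply Rle_trans with (RInt (fun x => 2 * B * C1 * d * (G th * / K x th' + G th' * / K x th)) 0 1).
    - apply Rle_trans with (RInt (fun x => Rabs (/ K x th' - / K x th)) 0 1).
      + apply abs_RInt_le; [lra|now apply ex_RInt_cts].
      + pose proof (invK_cts th HD). pose proof (invK_cts th' HD').
        apply RInt_le; [lra| | |intros x _; apply pt].
        * apply ex_RInt_cts. intros x. now apply cts_abs.
        * apply ex_RInt_cts. intros x.
          apply cts_mult; [apply cts_const|apply cts_plus; (apply cts_mult; [apply cts_const|auto])].
    - right. pose proof (invK_cts th HD). pose proof (invK_cts th' HD').
      rewrite (RInt_scal_cts (fun x => G th * / K x th' + G th' * / K x th)).
      2:{ intros x. apply cts_plus; (apply cts_mult; [apply cts_const|auto]). }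
      rewrite (RInt_plus_cts (fun x => G th * / K x th') (fun x => G th' * / K x th)).
      2,3: intros x; apply cts_mult; [apply cts_const|auto].
      rewrite !RInt_scal_cts by assumption.
      fold (G th) (G th'). ring. }
  replace (/ G th - / G th') with ((G th' - G th) * (/ G th * / G th')) by (field; lra).
  apply Rinv_0_lt_compat in P as J. apply Rinv_0_lt_compat in P' as J'.
  rewrite Rabs_mult, (Rabs_pos_eq (/ G th * / G th')) by (apply Rmult_le_pos; lra).
  apply Rle_trans with (4 * B * C1 * d * (G th * G th') * (/ G th * / G th')).
  - apply Rmult_le_compat_r; [apply Rmult_le_pos; lra|exact I].
  - right. field. lra.
Qed.

Lemma angle_exists : exists th h : R -> R,
  th 0 = 0 /\ (forall t, is_derive th t (h t)) /\ (forall t, 0 < h t) /\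
  (forall t x, 0 < K0 (u0 x) (v0 x) (th t)) /\
  (forall t, h t * RInt (fun x => / K0 (u0 x) (v0 x) (th t)) 0 1 = 1).
Proof.
  pose proof C1_pos as PC. pose proof M_ge0 as PM.
  assert (PB : 1 <= B) by (unfold B; lra).
  set (L := 4 * B * C1). assert (PL : 0 < L) by (unfold L; apply Rmult_lt_0_compat; lra).
  assert (HB : forall y, Rabs (H y) <= L).
  { intros y. rewrite Rabs_pos_eq by apply H_ge0. apply Rle_trans with (1 := H_le 0 y).
    unfold L. rewrite (Rmult_comm _ C1). apply Rmult_le_compat_l; [lra|].
    pose proof (nn_le 0 y). lra. }
  destruct (picard (fun _ y => H y) 0) as (th & th0 & Hth).
  - intros pt. apply (cts_comp H snd); [|apply cts_snd].
    apply filterlim_locally. intros eps.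
    assert (P : 0 < eps / L) by (apply Rdiv_lt_0_compat; [apply cond_pos|exact PL]).
    exists (mkposreal _ P). intros y Hy. change (Rabs (y - snd pt) < eps / L) in Hy.
    change (Rabs (H y - H (snd pt)) < eps).
    apply Rle_lt_trans with (1 := H_lip y (snd pt)).
    apply Rlt_le_trans with (L * (eps / L)); [now apply Rmult_lt_compat_l|].
    right. field. lra.
  - intros T. exists L. split; [exact PL|]. intros _ x y _. split; [apply HB|apply H_lip].
  (* [H] vanishes at singular angles, which makes them equilibria. Reaching one at time [t] would
     make [th] constant, so the angle 0 would be singular, whereas [K = 1] there for every label. *)
  - assert (nD : forall t, ~ D (th t)).
    { intros t HD. pose proof (autonomous_equilibrium H th L t H_lip Hth (H_D _ HD) 0) as E.
      rewrite <- E, th0 in HD. destruct HD as [x Hx]. revert Hx. unfold K, K0.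
      rewrite cos_0, sin_0. lra. }
    exists th, (fun t => H (th t)). split; [exact th0|]. split; [exact Hth|].
    split; [|split].
    + intros t. rewrite H_nD by apply nD. apply Rinv_0_lt_compat, G_pos, nD.
    + intros t x. apply (K_pos x (th t)), nD.
    + intros t. rewrite H_nD by apply nD.
      apply Rinv_l, Rgt_not_eq, (G_pos (th t) (nD t)).
Qed.
End Angle.


(** * The flow map *)

Section Flow.
Context (J Jt : R -> R -> R) (a al : R -> R).
Context (HJ : cont2 J) (HJt : cont2 Jt) (Jpos : forall x t, 0 < J x t).
Context (Jd : forall x t, is_derive (J x) t (Jt x t)).
Context (pJ : forall t, periodic1 (fun x => J x t)).
Context (massJ : forall t, RInt (fun x => J x t) 0 1 = 1).
Context (Ca : forall t, continuous a t).
Context (al_ode : forall t, is_derive al t (- 2 * a t / J (al t) t)).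

Let P x t := RInt (fun y => J y t) 0 x.
Let Q x t := RInt (fun y => Jt y t) 0 x.
(** Integrating the Jacobian from the label [al t] places that particle at z = 0 at time t. *)
Let Z x t := P x t - P (al t) t.

Local Lemma P_dx x t : is_derive (fun x => P x t) x (J x t).
Proof. apply (is_derive_RInt_cts (fun y => J y t)). now apply cont2_l. Qed.

Local Lemma P_dt x t : is_derive (P x) t (Q x t).
Proof.
  apply is_derive_RInt_cont2; try assumption.
  apply filter_forall. intros s y. apply Jd.
Qed.

Local Lemma Q_dx x t : is_derive (fun x => Q x t) x (Jt x t).
Proof. apply (is_derive_RInt_cts (fun y => Jt y t)). now apply cont2_l. Qed.

Local Lemma Q_cont2 : cont2 Q.
Proof.
  apply cont2_of_derive_l with Jt; [exact Q_dx|exact HJt|].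
  intros x. now apply continuous_RInt_cont2.
Qed.

Local Lemma Z_dx x t : is_derive (fun x => Z x t) x (J x t).
Proof.
  unfold Z. rewrite <- (Rminus_0_r (J x t)).
  apply (is_derive_minus (fun x => P x t) (fun _ => P (al t) t)); [apply P_dx|].
  apply (@is_derive_const R_AbsRing R_NormedModule).
Qed.

(** The moving base point contributes [J (al t) t] times the derivative of [al], and the label
    equation makes this [- 2 * a t]. The particle at z = 0 therefore has velocity [2 * a t], as the
    normalization of psi requires. *)
Local Lemma Z_dt x t : is_derive (Z x) t (2 * (a t + (Q x t - Q (al t) t) / 2)).
Proof.
  replace (2 * (a t + (Q x t - Q (al t) t) / 2)) with
    (Q x t - (J (al t) t * (- 2 * a t / J (al t) t) + Q (al t) t)).
  2:{ field. apply Rgt_not_eq, Jpos. }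
  apply (is_derive_minus (P x) (fun t => P (al t) t)); [apply P_dt|].
  apply is_derive_along; [exact P_dx|exact HJ|apply al_ode|apply P_dt].
Qed.

Local Lemma Z_cont2 : cont2 Z.
Proof.
  apply cont2_of_derive_l with J; [exact Z_dx|exact HJ|].
  intros x t. exact (is_derive_cts _ _ _ (Z_dt x t)).
Qed.

Local Lemma Z_incr x y t : x < y -> Z x t < Z y t.
Proof.
  intros Hxy. apply (incr_function (fun x => Z x t) m_infty p_infty (fun x => J x t)); simpl; trivial.
  - intros z _ _. apply Z_dx.
  - intros z _ _. apply Jpos.
Qed.

Local Lemma P_shift x t : P (x + 1) t = P x t + 1.
Proof.
  unfold P. rewrite <- (RInt_Chasles_cts (fun y => J y t) 0 x (x + 1)) by now apply cont2_l.
  rewrite RInt_periodic1 by (apply pJ || now apply cont2_l). now rewrite massJ.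
Qed.

(** The mass of a period is 1 at every time, so its time derivative vanishes. This yields the
    periodicity of psi. *)
Local Lemma Q_shift x t : Q (x + 1) t = Q x t.
Proof.
  rewrite <- (is_derive_unique _ _ _ (P_dt (x + 1) t)), <- (is_derive_unique _ _ _ (P_dt x t)).
  transitivity (Derive (fun s => P x s + 1) t).
  - apply Derive_ext. intros s. apply P_shift.
  - apply is_derive_unique. rewrite <- (Rplus_0_r (Derive (P x) t)).
    apply (is_derive_plus (P x) (fun _ => 1)).
    + apply Derive_correct. eexists. apply P_dt.
    + apply (@is_derive_const R_AbsRing R_NormedModule).
Qed.

(** By unit mass, [Z x t - x] is periodic in x, hence bounded, and the intermediate value theorem
    applies. *)
Local Lemma Z_surj z t : exists x, Z x t = z.
Proof.
  assert (Hc : forall x, continuous (fun x => Z x t) x) by (intros x; exact (is_derive_cts _ _ _ (Z_dx x t))).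
  destruct (periodic1_bounded (fun x => Z x t - x)) as [M [M0 HM]].
  - intros x. unfold Z. rewrite P_shift. ring.
  - intros x. apply cts_minus; [apply Hc|apply cts_id].
  - pose proof (HM (z - M)) as H1. pose proof (HM (z + M)) as H2.
    apply Rabs_le_between in H1. apply Rabs_le_between in H2.
    destruct (IVT_gen (fun x => Z x t) (z - M) (z + M) z) as [x [_ Hx]].
    + intros x. apply continuity_pt_filterlim, Hc.
    + split; [apply Rle_trans with (1 := Rmin_l _ _); lra|apply Rle_trans with (2 := Rmax_r _ _); lra].
    + now exists x.
Qed.

Lemma flow_exists : exists A psi : R -> R -> R,
  cont2 A /\ cont2 psi /\
  (forall z t, is_derive (fun z => A z t) z (/ J (A z t) t)) /\
  (forall z t, is_derive (A z) t (- 2 * psi z t / J (A z t) t)) /\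
  (forall z t, is_derive (fun z => psi z t) z (Jt (A z t) t / (2 * J (A z t) t))) /\
  (forall t, psi 0 t = a t) /\
  (forall z t, A (z + 1) t = A z t + 1) /\
  (forall t, periodic1 (fun z => psi z t)) /\
  ((forall x, J x 0 = 1) -> al 0 = 0 -> forall z, A z 0 = z).
Proof.
  pose (A := fun z t => proj1_sig (constructive_indefinite_description _ (Z_surj z t))).
  assert (ZA : forall z t, Z (A z t) t = z).
  { intros z t. exact (proj2_sig (constructive_indefinite_description _ (Z_surj z t))). }
  assert (Zinj : forall x y t, Z x t = Z y t -> x = y).
  { intros x y t E. destruct (Rtotal_order x y) as [L|[L|L]]; [|exact L|];
    apply (Z_incr _ _ t) in L; lra. }
  assert (CA : cont2 A) by (apply cont2_inverse with Z; [exact Z_cont2|intros; now apply Z_incr|exact ZA]).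
  assert (CQ := Q_cont2).
  assert (Cal : forall t, continuous al t) by (intros t; exact (is_derive_cts _ _ _ (al_ode t))).
  (* This is half the velocity of the particle at z, since the model transports with speed 2 psi. *)
  pose (psi := fun z t => a t + (Q (A z t) t - Q (al t) t) / 2).
  assert (Az : forall z t, is_derive (fun z => A z t) z (/ J (A z t) t)).
  { intros z t. replace (/ J (A z t) t) with (- (-1) / J (A z t) t) by (field; apply Rgt_not_eq, Jpos).
    (* Here time is frozen and the parameter [s] is the position; the function vanishes along [A]
       and has derivative -1 in [s]. *)
    apply (is_derive_implicit (fun x s => Z x t - s) (fun x _ => J x t) (fun z => A z t)).
    - intros x s. rewrite <- (Rminus_0_r (J x t)).
      apply (is_derive_minus (fun x => Z x t) (fun _ => s)); [apply Z_dx|].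
      apply (@is_derive_const R_AbsRing R_NormedModule).
    - intros p. cts.
    - intros; apply Jpos.
    - now apply cont2_l.
    - intros s. now rewrite !ZA, !Rminus_diag.
    - auto_derive; [trivial|ring]. }
  assert (Ash : forall z t, A (z + 1) t = A z t + 1).
  { intros z t. apply (Zinj _ _ t). rewrite ZA. unfold Z. rewrite P_shift.
    fold (Z (A z t) t). rewrite <- (ZA z t) at 1. unfold Z. ring. }
  exists A, psi. split; [exact CA|]. split; [|split; [exact Az|split; [|split; [|split; [|split; [exact Ash|split]]]]]].
  - intros p. unfold psi. cts. lra.
  - intros z t.
    replace (- 2 * psi z t / J (A z t) t) with (- (2 * psi z t) / J (A z t) t) by (field; apply Rgt_not_eq, Jpos).
    apply (is_derive_implicit Z J (A z)); [exact Z_dx|exact HJ|exact Jpos|now apply cont2_r| |apply Z_dt].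
    intros s. now rewrite !ZA.
  - intros z t. unfold psi.
    apply is_derive_ext with (fun z => (a t - Q (al t) t / 2) + / 2 * Q (A z t) t).
    { intros y. eqR. field. }
    replace (Jt (A z t) t / (2 * J (A z t) t)) with (0 + / 2 * (/ J (A z t) t * Jt (A z t) t))
      by (field; apply Rgt_not_eq, Jpos).
    apply (is_derive_plus (fun _ => a t - Q (al t) t / 2) (fun z => / 2 * Q (A z t) t)).
    + apply (@is_derive_const R_AbsRing R_NormedModule).
    + apply (is_derive_scal (fun z => Q (A z t) t)).
      apply (is_derive_comp (fun x => Q x t) (fun z => A z t)); [apply Q_dx|apply Az].
  - intros t. unfold psi. replace (A 0 t) with (al t); [field|].
    apply (Zinj _ _ t). rewrite ZA. unfold Z. ring.
  - intros t z. unfold psi. now rewrite Ash, Q_shift.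
  - intros J1 al0 z. apply (Zinj _ _ 0). rewrite ZA. unfold Z, P.
    rewrite al0, RInt_point.
    rewrite (RInt_ext (fun y => J y 0) (fun _ => 1)) by (intros; apply J1).
    rewrite RInt_const_R. change (z = (z - 0) * 1 - 0). ring.
Qed.
End Flow.


(** * The Lagrangian solution *)

Lemma is_derive_eq (f : R -> R) (x l l' : R) : is_derive f x l -> l = l' -> is_derive f x l'.
Proof. now intros H <-. Qed.

Section DerivativeRules.
Context (f g : R -> R) (x lf lg : R).
Context (Hf : is_derive f x lf) (Hg : is_derive g x lg).

Lemma der_plus : is_derive (fun y => f y + g y) x (lf + lg).
Proof using Hf Hg. exact (is_derive_plus f g x lf lg Hf Hg). Qed.

Lemma der_minus : is_derive (fun y => f y - g y) x (lf - lg).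
Proof using Hf Hg. exact (is_derive_minus f g x lf lg Hf Hg). Qed.

Lemma der_opp : is_derive (fun y => - f y) x (- lf).
Proof using Hf. exact (is_derive_opp f x lf Hf). Qed.

Lemma der_mult : is_derive (fun y => f y * g y) x (lf * g x + f x * lg).
Proof using Hf Hg. exact (is_derive_mult f g x lf lg Hf Hg Rmult_comm). Qed.

Lemma der_sqr : is_derive (fun y => f y ^ 2) x (2 * f x * lf).
Proof using Hf.
  apply is_derive_eq with (1 := is_derive_pow f 2 x lf Hf). simpl. ring.
Qed.

Lemma der_sin : is_derive (fun y => sin (f y)) x (lf * cos (f x)).
Proof using Hf. exact (is_derive_comp sin f x _ _ (is_derive_sin _) Hf). Qed.

Lemma der_cos : is_derive (fun y => cos (f y)) x (lf * - sin (f x)).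
Proof using Hf. exact (is_derive_comp cos f x _ _ (is_derive_cos _) Hf). Qed.

Lemma der_div : g x <> 0 ->
  is_derive (fun y => f y / g y) x ((lf * g x - f x * lg) / g x ^ 2).
Proof using Hf Hg. intros H. exact (is_derive_div f g x lf lg Hf Hg H). Qed.
End DerivativeRules.

Lemma der_const (c x : R) : is_derive (fun _ : R => c) x 0.
Proof. apply (@is_derive_const R_AbsRing R_NormedModule). Qed.

Ltac der_step :=
  match goal with
  | |- is_derive _ _ _ => eassumption
  | |- is_derive (fun y => @?f y + @?g y) _ _ => apply (der_plus f g)
  | |- is_derive (fun y => @?f y - @?g y) _ _ => apply (der_minus f g)
  | |- is_derive (fun y => - @?f y) _ _ => apply (der_opp f)
  | |- is_derive (fun y => @?f y * @?g y) _ _ => apply (der_mult f g)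
  | |- is_derive (fun y => @?f y / @?g y) _ _ => apply (der_div f g)
  | |- is_derive (fun y => @?f y ^ 2) _ _ => apply (der_sqr f)
  | |- is_derive (fun y => sin (@?f y)) _ _ => apply (der_sin f)
  | |- is_derive (fun y => cos (@?f y)) _ _ => apply (der_cos f)
  | |- is_derive (fun y => y) _ _ => apply (@is_derive_id R_AbsRing)
  | |- is_derive _ _ _ => apply der_const
  end; cbv beta.

(** The rules compute the derivative into an existential variable, with facts in context as leaves.
    What remains is the nonvanishing of denominators and one algebraic equality. *)
Ltac der := eapply is_derive_eq; [repeat der_step|].

(** * Algebra of the quadratic form [K0] and of the fields built from it *)

(** [K1] and [K2] are the first two derivatives of [K0] in the angle; [dK0] and [dK1] are the total
    differentials of [K0] and [K1]. *)
Definition K1 (u v th : R) : R :=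
  2 * (cos th + v * sin th) * (- sin th + v * cos th) + 2 * u ^ 2 * sin th * cos th.
Definition K2 (u v th : R) : R :=
  2 * (- sin th + v * cos th) ^ 2 - 2 * (cos th + v * sin th) ^ 2
  + 2 * u ^ 2 * (cos th ^ 2 - sin th ^ 2).
Definition dK0 (u v th du dv dth : R) : R :=
  2 * u * sin th ^ 2 * du + 2 * (cos th + v * sin th) * sin th * dv + K1 u v th * dth.
Definition dK1 (u v th du dv dth : R) : R :=
  4 * u * sin th * cos th * du
  + (2 * sin th * (- sin th + v * cos th) + 2 * (cos th + v * sin th) * cos th) * dv
  + K2 u v th * dth.

Section ChainRule.
Context (X Y T : R -> R) (s x y th : R).
Context (HX : is_derive X s x) (HY : is_derive Y s y) (HT : is_derive T s th).

Lemma is_derive_K0 :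
  is_derive (fun s => K0 (X s) (Y s) (T s)) s (dK0 (X s) (Y s) (T s) x y th).
Proof using HX HY HT. unfold K0. der. unfold dK0, K1. ring. Qed.

Lemma is_derive_K1 :
  is_derive (fun s => K1 (X s) (Y s) (T s)) s (dK1 (X s) (Y s) (T s) x y th).
Proof using HX HY HT. unfold K1. der. unfold dK1, K2. ring. Qed.
End ChainRule.

(* [K0] is [|X|^2] for a vector [X] rotating in the plane, with [X'' = - X] and
   angular momentum [u]. *)
Lemma K_identity u v th :
  2 * K0 u v th * K2 u v th - K1 u v th ^ 2 - 4 * u ^ 2 = - 4 * K0 u v th ^ 2.
Proof.
  assert (E : forall s c, s * s + c * c = 1 ->
    2 * ((c + v * s) ^ 2 + (u * s) ^ 2) *
      (2 * (- s + v * c) ^ 2 - 2 * (c + v * s) ^ 2 + 2 * u ^ 2 * (c ^ 2 - s ^ 2))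
    - (2 * (c + v * s) * (- s + v * c) + 2 * u ^ 2 * s * c) ^ 2 - 4 * u ^ 2
    = - 4 * ((c + v * s) ^ 2 + (u * s) ^ 2) ^ 2).
  { intros s c H.
    (* Multiplying by [(s^2 + c^2)^2 = 1] makes every term of degree 4 in (s,c), after which the
       identity is polynomial. *)
    replace (4 * u ^ 2) with (4 * u ^ 2 * (s * s + c * c) ^ 2) by (rewrite H; ring). ring. }
  apply E. exact (sin2_cos2 th).
Qed.

(* Derivatives of [u = X H / K0] and [v = (H K1 / K0 - H1) / 2]. *)
Definition dU (X Y T H X' Y' T' H' : R) : R :=
  (X' * H + X * H') / K0 X Y T - X * H * dK0 X Y T X' Y' T' / K0 X Y T ^ 2.
Definition dV (X Y T H X' Y' T' H' H1' : R) : R :=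
  (H' * K1 X Y T / K0 X Y T + H * dK1 X Y T X' Y' T' / K0 X Y T
   - H * K1 X Y T * dK0 X Y T X' Y' T' / K0 X Y T ^ 2 - H1') / 2.

Lemma is_derive_U (X Y T H : R -> R) s x y th h :
  is_derive X s x -> is_derive Y s y -> is_derive T s th -> is_derive H s h ->
  K0 (X s) (Y s) (T s) <> 0 ->
  is_derive (fun s => X s * H s / K0 (X s) (Y s) (T s)) s
    (dU (X s) (Y s) (T s) (H s) x y th h).
Proof.
  intros HX HY HT HH Hk. pose proof (is_derive_K0 X Y T s x y th HX HY HT) as HK.
  der; [exact Hk|]. unfold dU. field. exact Hk.
Qed.

Lemma is_derive_V (X Y T H H1 : R -> R) s x y th h h1 :
  is_derive X s x -> is_derive Y s y -> is_derive T s th -> is_derive H s h ->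
  is_derive H1 s h1 -> K0 (X s) (Y s) (T s) <> 0 ->
  is_derive (fun s => (H s * K1 (X s) (Y s) (T s) / K0 (X s) (Y s) (T s) - H1 s) / 2) s
    (dV (X s) (Y s) (T s) (H s) x y th h h1).
Proof.
  intros HX HY HT HH HH1 Hk. pose proof (is_derive_K0 X Y T s x y th HX HY HT) as HK.
  pose proof (is_derive_K1 X Y T s x y th HX HY HT) as HK'.
  der; [exact Hk|lra|]. unfold dV. field. exact Hk.
Qed.

(** [X] and [Y] are carried by the flow, so their time derivatives are [- 2 * psi] times their
    z-derivatives [x] and [y], and these contributions cancel. Only the derivatives through the
    angle and its speed [H] remain. *)
Lemma U_equation X Y T H H1 x y psi : K0 X Y T <> 0 ->
  dU X Y T H (- 2 * psi * x) (- 2 * psi * y) H (H * H1) + 2 * psi * dU X Y T H x y 0 0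
  = - 2 * ((H * K1 X Y T / K0 X Y T - H1) / 2) * (X * H / K0 X Y T).
Proof. intros Hk. unfold dU, dK0. field. exact Hk. Qed.

(** [K_identity] expresses [K2] through [K1 ^ 2], [X ^ 2] and [K0 ^ 2]; the term in [X ^ 2] becomes
    [u ^ 2], and the one in [K0 ^ 2] becomes [- H ^ 2]. The final bracket is c(t) = r''/r - 1/r^4
    for the radius r = H^(-1/2) of (phi1, phi2). *)
Lemma V_equation X Y T H H1 H2 x y psi : K0 X Y T <> 0 ->
  dV X Y T H (- 2 * psi * x) (- 2 * psi * y) H (H * H1) (H * H2) + 2 * psi * dV X Y T H x y 0 0 0
  = (X * H / K0 X Y T) ^ 2 - ((H * K1 X Y T / K0 X Y T - H1) / 2) ^ 2
    + (H1 ^ 2 / 4 - H * H2 / 2 - H ^ 2).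
Proof.
  intros Hk. unfold dV, dK0, dK1.
  replace (K2 X Y T) with ((K1 X Y T ^ 2 + 4 * X ^ 2 - 4 * K0 X Y T ^ 2) / (2 * K0 X Y T)).
  2:{ pose proof (K_identity X Y T). apply Rmult_eq_reg_l with (2 * K0 X Y T); [|lra].
      replace (2 * K0 X Y T * ((K1 X Y T ^ 2 + 4 * X ^ 2 - 4 * K0 X Y T ^ 2) / (2 * K0 X Y T)))
        with (K1 X Y T ^ 2 + 4 * X ^ 2 - 4 * K0 X Y T ^ 2) by (field; exact Hk). lra. }
  field. exact Hk.
Qed.

Lemma periodic1_C1_lipschitz (f df : R -> R) : periodic1 f ->
  (forall x, is_derive f x (df x)) -> (forall x, continuous df x) ->
  exists N, 0 <= N /\ forall x y, Rabs (f x - f y) <= N * Rabs (x - y).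
Proof.
  intros Hp Hd Hc.
  destruct (periodic1_bounded df (periodic1_derive f df Hd Hp) Hc) as [N [N0 HN]].
  exists N. split; [exact N0|]. intros x y.
  destruct (mean_value f df y x Hd) as [c [_ ->]].
  rewrite Rabs_mult. apply Rmult_le_compat_r; [apply Rabs_pos|apply HN].
Qed.

Lemma class_C_le n k f : (k <= n)%nat -> class_C n f -> class_C k f.
Proof.
  intros H. induction H as [|n H IH]; [trivial|]. intros Hf. now apply IH, class_C_S.
Qed.


Lemma cts_K0 {T : UniformSpace} (f g k : T -> R) (p : T) :
  continuous f p -> continuous g p -> continuous k p ->
  continuous (fun q => K0 (f q) (g q) (k q)) p.
Proof. intros. unfold K0. cts; assumption. Qed.

Lemma cts_K1 {T : UniformSpace} (f g k : T -> R) (p : T) :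
  continuous f p -> continuous g p -> continuous k p ->
  continuous (fun q => K1 (f q) (g q) (k q)) p.
Proof. intros. unfold K1. cts; assumption. Qed.

Lemma cts_K2 {T : UniformSpace} (f g k : T -> R) (p : T) :
  continuous f p -> continuous g p -> continuous k p ->
  continuous (fun q => K2 (f q) (g q) (k q)) p.
Proof. intros. unfold K2. cts; assumption. Qed.

(** * Time regularity of the Jacobian, the label at the origin and the resulting fields *)

Section Lagrangian.
Context (u0 v0 du dv th h : R -> R).
Context (Hdu : forall x, is_derive u0 x (du x)) (Hdv : forall x, is_derive v0 x (dv x)).
Context (Cdu : forall x, continuous du x) (Cdv : forall x, continuous dv x).
Context (pu : periodic1 u0) (pv : periodic1 v0).
Context (mean0 : RInt v0 0 1 = 0).
Context (th0 : th 0 = 0) (Hth : forall t, is_derive th t (h t)) (hpos : forall t, 0 < h t).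
Context (Kpos : forall t x, 0 < K0 (u0 x) (v0 x) (th t)).
Context (hK : forall t, h t * RInt (fun x => / K0 (u0 x) (v0 x) (th t)) 0 1 = 1).

Let k0 x t := K0 (u0 x) (v0 x) (th t).
Let k1 x t := K1 (u0 x) (v0 x) (th t).
Let k2 x t := K2 (u0 x) (v0 x) (th t).

Local Lemma Cu0 x : continuous u0 x.
Proof. exact (is_derive_cts _ _ _ (Hdu x)). Qed.
Local Lemma Cv0 x : continuous v0 x.
Proof. exact (is_derive_cts _ _ _ (Hdv x)). Qed.
Local Lemma Cth t : continuous th t.
Proof. exact (is_derive_cts _ _ _ (Hth t)). Qed.

Local Lemma k0_neq0 x t : k0 x t <> 0.
Proof. apply Rgt_not_eq, Kpos. Qed.

Local Lemma Ck0 : cont2 k0.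
Proof. pose proof Cu0; pose proof Cv0; pose proof Cth. intros p. apply cts_K0; cts. Qed.
Local Lemma Ck1 : cont2 k1.
Proof. pose proof Cu0; pose proof Cv0; pose proof Cth. intros p. apply cts_K1; cts. Qed.
Local Lemma Ck2 : cont2 k2.
Proof. pose proof Cu0; pose proof Cv0; pose proof Cth. intros p. apply cts_K2; cts. Qed.

Local Lemma k0_dt x t : is_derive (k0 x) t (h t * k1 x t).
Proof.
  apply is_derive_eq with (dK0 (u0 x) (v0 x) (th t) 0 0 (h t)).
  - apply (is_derive_K0 (fun _ => u0 x) (fun _ => v0 x) th); (apply der_const || apply Hth).
  - unfold dK0. fold (k1 x t). ring.
Qed.

Local Lemma k1_dt x t : is_derive (k1 x) t (h t * k2 x t).
Proof.
  apply is_derive_eq with (dK1 (u0 x) (v0 x) (th t) 0 0 (h t)).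
  - apply (is_derive_K1 (fun _ => u0 x) (fun _ => v0 x) th); (apply der_const || apply Hth).
  - unfold dK1. fold (k2 x t). ring.
Qed.

Let g t := RInt (fun x => / k0 x t) 0 1.
Let i1 x t := k1 x t / k0 x t ^ 2.
Let i2 x t := (k2 x t * k0 x t - 2 * k1 x t ^ 2) / k0 x t ^ 3.
Let I1 t := RInt (fun x => i1 x t) 0 1.
Let I2 t := RInt (fun x => i2 x t) 0 1.
(** Since [th' = h], a time derivative is [h] times an angular derivative. [h1] and [h2] are the
    first two angular derivatives of [1 / G], and time derivatives appear as [h * h1] and
    [h * h2]. *)
Let h1 t := h t ^ 2 * I1 t.
Let h2 t := 2 * h t * h1 t * I1 t + h t ^ 2 * I2 t.

Local Lemma Ci1 : cont2 i1.
Proof.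
  pose proof Ck0; pose proof Ck1. intros p. unfold i1. cts. apply pow_nonzero, k0_neq0.
Qed.
Local Lemma Ci2 : cont2 i2.
Proof.
  pose proof Ck0; pose proof Ck1; pose proof Ck2. intros p. unfold i2. cts.
  apply pow_nonzero, k0_neq0.
Qed.

Local Lemma g_h t : g t = / h t.
Proof.
  pose proof (hpos t). apply Rmult_eq_reg_l with (h t); [|lra].
  unfold g, k0. rewrite hK. field. lra.
Qed.

(** Start of a bootstrap: [h] is given only as the derivative of [th], but it is also the reciprocal
    of an integral depending on t through [th], which is continuous. Continuity of [h] then allows
    differentiating that integral. *)
Local Lemma Ch t : continuous h t.
Proof.
  apply continuous_ext with (fun t => / g t).
  - intros s. rewrite g_h. apply Rinv_inv.
  - apply cts_inv.
    + rewrite g_h. pose proof (hpos t). apply Rinv_neq_0_compat. lra.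
    + apply (continuous_RInt_cont2 (fun x t => / k0 x t)).
      pose proof Ck0. intros p. cts. apply k0_neq0.
Qed.

Local Lemma h_dt t : is_derive h t (h t * h1 t).
Proof.
  pose proof Ch as Ch'.
  assert (G : is_derive g t (- h t * I1 t)).
  { apply is_derive_eq with (RInt (fun x => - h t * i1 x t) 0 1).
    - apply (is_derive_RInt_cont2 (fun x t => / k0 x t) (fun x t => - h t * i1 x t)).
      + apply filter_forall. intros s x. pose proof (k0_neq0 x s) as N. pose proof (k0_dt x s) as D.
        apply is_derive_eq with (1 := is_derive_inv _ _ _ D N). unfold i1. field. exact N.
      + pose proof Ck0. intros p. cts. apply k0_neq0.
      + pose proof Ci1. intros p. cts.
    - apply (RInt_scal_cts (fun x => i1 x t)). apply cont2_l, Ci1. }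
  pose proof (hpos t) as P.
  apply is_derive_ext with (fun t => / g t).
  { intros s. rewrite g_h. apply Rinv_inv. }
  assert (N : g t <> 0) by (rewrite g_h; apply Rinv_neq_0_compat; lra).
  apply is_derive_eq with (1 := is_derive_inv _ _ _ G N).
  rewrite g_h. unfold h1. field. lra.
Qed.

Local Lemma I1_dt t : is_derive I1 t (h t * I2 t).
Proof.
  pose proof Ch as Ch'.
  apply is_derive_eq with (RInt (fun x => h t * i2 x t) 0 1).
  - apply (is_derive_RInt_cont2 i1 (fun x t => h t * i2 x t)).
    + apply filter_forall. intros s x.
      pose proof (k0_neq0 x s) as N. pose proof (k0_dt x s) as D. pose proof (k1_dt x s) as D1.
      change (is_derive (fun s => k1 x s / k0 x s ^ 2) s (h s * i2 x s)).
      der; [now apply pow_nonzero|]. unfold i2. field. exact N.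
    + exact Ci1.
    + pose proof Ci2. intros p. cts.
  - apply (RInt_scal_cts (fun x => i2 x t)). apply cont2_l, Ci2.
Qed.

Local Lemma h1_dt t : is_derive h1 t (h t * h2 t).
Proof.
  pose proof (h_dt t) as D. pose proof (I1_dt t) as D1. unfold h1. der.
  unfold h2. fold (h1 t). ring.
Qed.

Local Lemma Ch1 t : continuous h1 t.
Proof. exact (is_derive_cts _ _ _ (h1_dt t)). Qed.

Local Lemma Ch2 t : continuous h2 t.
Proof.
  pose proof Ch. pose proof Ch1.
  assert (forall t, continuous I1 t) by (intros s; exact (is_derive_cts _ _ _ (I1_dt s))).
  assert (forall t, continuous I2 t) by (apply (continuous_RInt_cont2 i2), Ci2).
  unfold h2. cts.
Qed.

Let J x t := h t / k0 x t.
Let Jt x t := J x t * (h1 t - h t * k1 x t / k0 x t).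

Local Lemma CJ : cont2 J.
Proof. pose proof Ck0; pose proof Ch. intros p. unfold J. cts. apply k0_neq0. Qed.

Local Lemma CJt : cont2 Jt.
Proof.
  pose proof Ck0; pose proof Ck1; pose proof Ch; pose proof Ch1; pose proof CJ.
  intros p. unfold Jt. cts. apply k0_neq0.
Qed.

Local Lemma J_pos x t : 0 < J x t.
Proof. apply Rdiv_lt_0_compat; [apply hpos|apply Kpos]. Qed.

Local Lemma J_dt x t : is_derive (J x) t (Jt x t).
Proof.
  pose proof (k0_neq0 x t) as N. pose proof (k0_dt x t). pose proof (h_dt t).
  unfold J. der; [exact N|]. unfold Jt, J. field. exact N.
Qed.

Local Lemma J_periodic t : periodic1 (fun x => J x t).
Proof. intros x. unfold J, k0. now rewrite pu, pv. Qed.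

Local Lemma J_mass t : RInt (fun x => J x t) 0 1 = 1.
Proof.
  unfold J, Rdiv. rewrite (RInt_scal_cts (fun x => / k0 x t)); [apply hK|].
  pose proof Ck0. intros x. cts. apply k0_neq0.
Qed.

Local Lemma k0_0 x : k0 x 0 = 1.
Proof. unfold k0, K0. rewrite th0, cos_0, sin_0. ring. Qed.

Local Lemma k1_0 x : k1 x 0 = 2 * v0 x.
Proof. unfold k1, K1. rewrite th0, cos_0, sin_0. ring. Qed.

Local Lemma h_0 : h 0 = 1.
Proof.
  assert (G : g 0 = 1).
  { unfold g. rewrite (RInt_ext _ (fun _ => 1)).
    - rewrite RInt_const_R. eqR. ring.
    - intros x _. rewrite k0_0. apply Rinv_1. }
  rewrite g_h in G. rewrite <- (Rinv_inv (h 0)), G. apply Rinv_1.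
Qed.

(** The mean condition on [v0] enters here. Since [k0 = 1] and [k1 = 2 * v0] at time 0, it makes the
    constructed [v] start from [v0] with no additive constant. *)
Local Lemma h1_0 : h1 0 = 0.
Proof.
  unfold h1, I1. rewrite (RInt_ext _ (fun x => 2 * v0 x)).
  - rewrite (RInt_scal_cts v0), mean0 by apply Cv0. eqR. ring.
  - intros x _. unfold i1. rewrite k0_0, k1_0. eqR. field.
Qed.

Context (a : R -> R) (Ca : forall t, continuous a t).
Context (MM NN : R).
Context (Bu : forall x, Rabs (u0 x) <= MM) (Bv : forall x, Rabs (v0 x) <= MM).
Context (N0 : 0 <= NN).
Context (Lu : forall x y, Rabs (u0 x - u0 y) <= NN * Rabs (x - y)).
Context (Lv : forall x y, Rabs (v0 x - v0 y) <= NN * Rabs (x - y)).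

(* The label of the particle that sits at [z = 0]. *)
Local Lemma label_exists : exists al : R -> R,
  al 0 = 0 /\ forall t, is_derive al t (- 2 * a t / J (al t) t).
Proof.
  assert (M0 : 0 <= MM) by (apply Rle_trans with (2 := Bu 0), Rabs_pos).
  pose (b := fun t => - 2 * a t / h t).
  assert (Cb : forall t, continuous b t).
  { intros t. pose proof Ch. pose proof (hpos t). unfold b. cts. lra. }
  destruct (picard (fun t y => b t * k0 y t) 0) as (al & al0 & Hal).
  - pose proof Ck0. intros p. cts.
  - intros T.
    destruct (bounded_continuity b (- T) T) as [M HM]; [intros; apply Cb|].
    set (B := 1 + MM + MM).
    set (W := Rabs M + 1).
    assert (W0 : 0 < W) by (unfold W; pose proof (Rabs_pos M); lra).
    (* [W] bounds the factor [b], [B ^ 2] bounds [k0], and [4 * B * NN] is the Lipschitz constant of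
       [k0] in the label, [2 * B * NN] from each square. The 1 ensures positivity. *)
    exists (W * (B ^ 2 + 4 * B * NN + 1)). split.
    { apply Rmult_lt_0_compat; [exact W0|]. unfold B. nra. }
    intros t x y Ht.
    assert (Hb : Rabs (b t) <= W).
    { apply Rabs_le_between in Ht. pose proof (HM t Ht) as HMt. change (Rabs (b t) < M) in HMt.
      unfold W. pose proof (Rle_abs M). lra. }
    assert (S : forall c, Rabs (c * sin (th t)) <= Rabs c).
    { intros c. rewrite Rabs_mult. pose proof (Rabs_sin_le (th t)). pose proof (Rabs_pos c). nra. }
    assert (Bp : forall x, Rabs (cos (th t) + v0 x * sin (th t)) <= B).
    { intros z. pose proof (Rabs_triang (cos (th t)) (v0 z * sin (th t))).
      pose proof (Rabs_cos_le (th t)). pose proof (S (v0 z)). pose proof (Bv z). unfold B. lra. }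
    assert (Bq : forall x, Rabs (u0 x * sin (th t)) <= MM).
    { intros z. apply Rle_trans with (1 := S (u0 z)), Bu. }
    pose proof (Rabs_pos (b t)) as b0.
    split; rewrite ?Rabs_mult.
    + apply Rmult_le_compat; try apply Rabs_pos; [exact Hb|].
      unfold k0, K0. rewrite Rabs_pos_eq by (apply Rplus_le_le_0_compat; apply pow2_ge_0).
      rewrite <- (pow2_abs (cos (th t) + v0 x * sin (th t))), <- (pow2_abs (u0 x * sin (th t))).
      pose proof (pow_incr _ _ 2 (conj (Rabs_pos _) (Bp x))).
      assert (Rabs (cos (th t) + v0 x * sin (th t)) + Rabs (u0 x * sin (th t)) <= B).
      { pose proof (Rabs_triang (cos (th t)) (v0 x * sin (th t))).
        pose proof (Rabs_cos_le (th t)). pose proof (S (v0 x)). pose proof (Bv x).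
        pose proof (Bq x). unfold B. lra. }
      pose proof (Rabs_pos (cos (th t) + v0 x * sin (th t))).
      pose proof (Rabs_pos (u0 x * sin (th t))).
      assert (0 <= 4 * B * NN) by (repeat apply Rmult_le_pos; unfold B; lra).
      nra.
    + rewrite <- Rmult_minus_distr_l, Rabs_mult, Rmult_assoc.
      apply Rmult_le_compat; try apply Rabs_pos; [exact Hb|].
      unfold k0, K0.
      replace ((cos (th t) + v0 x * sin (th t)) ^ 2 + (u0 x * sin (th t)) ^ 2 -
        ((cos (th t) + v0 y * sin (th t)) ^ 2 + (u0 y * sin (th t)) ^ 2)) with
        (((v0 x - v0 y) * sin (th t)) * ((cos (th t) + v0 x * sin (th t)) + (cos (th t) + v0 y * sin (th t)))
         + ((u0 x - u0 y) * sin (th t)) * (u0 x * sin (th t) + u0 y * sin (th t))) by ring.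
      apply Rle_trans with (1 := Rabs_triang _ _). rewrite 2!(Rabs_mult (_ * sin _)).
      pose proof (Rle_trans _ _ _ (S (v0 x - v0 y)) (Lv x y)) as E1.
      pose proof (Rle_trans _ _ _ (S (u0 x - u0 y)) (Lu x y)) as E2.
      assert (E3 : Rabs ((cos (th t) + v0 x * sin (th t)) + (cos (th t) + v0 y * sin (th t))) <= 2 * B).
      { apply Rle_trans with (1 := Rabs_triang _ _). pose proof (Bp x). pose proof (Bp y). lra. }
      assert (E4 : Rabs (u0 x * sin (th t) + u0 y * sin (th t)) <= 2 * B).
      { apply Rle_trans with (1 := Rabs_triang _ _). pose proof (Bq x). pose proof (Bq y). unfold B. lra. }
      pose proof (Rmult_le_compat _ _ _ _ (Rabs_pos _) (Rabs_pos _) E1 E3).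
      pose proof (Rmult_le_compat _ _ _ _ (Rabs_pos _) (Rabs_pos _) E2 E4).
      assert (0 <= (B ^ 2 + 1) * Rabs (x - y)).
      { apply Rmult_le_pos; [|apply Rabs_pos]. pose proof (pow2_ge_0 B). lra. }
      lra.
  - exists al. split; [exact al0|]. intros t.
    apply is_derive_eq with (1 := Hal t). unfold b, J. field.
    split; [apply k0_neq0|apply Rgt_not_eq, hpos].
Qed.

Context (m : nat) (CCu : class_C m u0) (CCv : class_C m v0).

(** The fields are [u0 * J] and [- Jt / (2 * J)] read at the label [A z t]. The function [c] is left
    unspecified because its value follows afterwards from the equation and periodicity alone. *)
Lemma lagrangian_solution : exists u v psi uz ut vz vt : R -> R -> R,
  (forall z, u z 0 = u0 z /\ v z 0 = v0 z) /\
  (forall t, periodic1 (fun z => u z t) /\ periodic1 (fun z => v z t) /\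
    periodic1 (fun z => psi z t)) /\
  (forall z t, is_derive (fun y => psi y t) z (- v z t)) /\
  (forall t, psi 0 t = a t) /\
  (forall z t, is_derive (fun y => u y t) z (uz z t)) /\
  (forall z t, is_derive (u z) t (ut z t)) /\
  (forall z t, is_derive (fun y => v y t) z (vz z t)) /\
  (forall z t, is_derive (v z) t (vt z t)) /\
  (cont2 u /\ cont2 uz /\ cont2 ut /\ cont2 v /\ cont2 vz /\ cont2 vt) /\
  (forall z t, ut z t + 2 * psi z t * uz z t = - 2 * v z t * u z t) /\
  (exists c : R -> R, forall z t,
    vt z t + 2 * psi z t * vz z t = u z t ^ 2 - v z t ^ 2 + c t) /\
  (forall t, class_C m (fun z => u z t) /\ class_C m (fun z => v z t)).
Proof.
  destruct label_exists as (al & al0 & Hal).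
  destruct (flow_exists J Jt a al CJ CJt J_pos J_dt J_periodic J_mass Ca Hal)
    as (A & psi & CA & Cpsi & Az & At & psiz & psi0 & Ash & ppsi & A0).
  assert (HA0 : forall z, A z 0 = z).
  { apply A0; [|exact al0]. intros x. unfold J. rewrite k0_0, h_0. field. }
  pose (X := fun z t => u0 (A z t)). pose (Y := fun z t => v0 (A z t)).
  pose (X' := fun z t => du (A z t) / J (A z t) t).
  pose (Y' := fun z t => dv (A z t) / J (A z t) t).
  assert (Xz : forall z t, is_derive (fun z => X z t) z (X' z t)).
  { intros z t. apply is_derive_eq with (1 := is_derive_comp u0 (fun z => A z t) z _ _ (Hdu _) (Az z t)).
    unfold X'. apply Rmult_comm. }
  assert (Yz : forall z t, is_derive (fun z => Y z t) z (Y' z t)).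
  { intros z t. apply is_derive_eq with (1 := is_derive_comp v0 (fun z => A z t) z _ _ (Hdv _) (Az z t)).
    unfold Y'. apply Rmult_comm. }
  assert (Xt : forall z t, is_derive (X z) t (- 2 * psi z t * X' z t)).
  { intros z t. apply is_derive_eq with (1 := is_derive_comp u0 (A z) t _ _ (Hdu _) (At z t)).
    unfold X'. change (- 2 * psi z t / J (A z t) t * du (A z t) = - 2 * psi z t * (du (A z t) / J (A z t) t)).
    unfold Rdiv. ring. }
  assert (Yt : forall z t, is_derive (Y z) t (- 2 * psi z t * Y' z t)).
  { intros z t. apply is_derive_eq with (1 := is_derive_comp v0 (A z) t _ _ (Hdv _) (At z t)).
    unfold Y'. change (- 2 * psi z t / J (A z t) t * dv (A z t) = - 2 * psi z t * (dv (A z t) / J (A z t) t)).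
    unfold Rdiv. ring. }
  assert (KN : forall z t, K0 (X z t) (Y z t) (th t) <> 0) by (intros z t; apply (k0_neq0 (A z t) t)).
  assert (CX : cont2 X) by (pose proof Cu0; intros p; unfold X; cts).
  assert (CY : cont2 Y) by (pose proof Cv0; intros p; unfold Y; cts).
  assert (CX' : cont2 X').
  { pose proof CJ; intros p; unfold X'; cts. apply Rgt_not_eq, J_pos. }
  assert (CY' : cont2 Y').
  { pose proof CJ; intros p; unfold Y'; cts. apply Rgt_not_eq, J_pos. }
  pose proof Cth as Cth'. pose proof Ch as Ch'. pose proof Ch1 as Ch1'. pose proof Ch2 as Ch2'.
  assert (CK0 : cont2 (fun z t => K0 (X z t) (Y z t) (th t))) by (intros p; unfold K0; cts).
  assert (CK1 : cont2 (fun z t => K1 (X z t) (Y z t) (th t))) by (intros p; unfold K1; cts).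
  pose (u := fun z t => X z t * h t / K0 (X z t) (Y z t) (th t)).
  pose (v := fun z t => (h t * K1 (X z t) (Y z t) (th t) / K0 (X z t) (Y z t) (th t) - h1 t) / 2).
  pose (uz := fun z t => dU (X z t) (Y z t) (th t) (h t) (X' z t) (Y' z t) 0 0).
  pose (ut := fun z t => dU (X z t) (Y z t) (th t) (h t)
    (- 2 * psi z t * X' z t) (- 2 * psi z t * Y' z t) (h t) (h t * h1 t)).
  pose (vz := fun z t => dV (X z t) (Y z t) (th t) (h t) (X' z t) (Y' z t) 0 0 0).
  pose (vt := fun z t => dV (X z t) (Y z t) (th t) (h t)
    (- 2 * psi z t * X' z t) (- 2 * psi z t * Y' z t) (h t) (h t * h1 t) (h t * h2 t)).
  exists u, v, psi, uz, ut, vz, vt.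
  split; [|split; [|split; [|split; [exact psi0|split; [|split; [|split; [|split; [|split; [|split; [|split]]]]]]]]]].
  - intros z. unfold u, v, X, Y. rewrite HA0.
    fold (k0 z 0) (k1 z 0). rewrite k0_0, k1_0, h_0, h1_0. split; field.
  - intros t. split; [|split; [|apply ppsi]]; intros z; unfold u, v, X, Y; now rewrite Ash, pu, pv.
  - intros z t. apply is_derive_eq with (1 := psiz z t).
    unfold v, X, Y, Jt. fold (k0 (A z t) t) (k1 (A z t) t).
    field. split; [apply k0_neq0|apply Rgt_not_eq, J_pos].
  - intros z t. apply (is_derive_U (fun z => X z t) (fun z => Y z t) (fun _ => th t) (fun _ => h t));
      (apply Xz || apply Yz || apply der_const || apply KN).
  - intros z t. apply (is_derive_U (X z) (Y z) th h);
      (apply Xt || apply Yt || apply Hth || apply h_dt || apply KN).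
  - intros z t. apply (is_derive_V (fun z => X z t) (fun z => Y z t) (fun _ => th t) (fun _ => h t) (fun _ => h1 t));
      (apply Xz || apply Yz || apply der_const || apply KN).
  - intros z t. apply (is_derive_V (X z) (Y z) th h h1);
      (apply Xt || apply Yt || apply Hth || apply h_dt || apply h1_dt || apply KN).
  - assert (CdK : forall f g k : R -> R -> R, cont2 f -> cont2 g -> cont2 k ->
      cont2 (fun z t => dK0 (X z t) (Y z t) (th t) (f z t) (g z t) (k z t)) /\
      cont2 (fun z t => dK1 (X z t) (Y z t) (th t) (f z t) (g z t) (k z t))).
    { intros f g' k Cf Cg Ck. split; intros p; unfold dK0, dK1, K1, K2; cts. }
    assert (Cpsi' : forall f, cont2 f -> cont2 (fun z t => - 2 * psi z t * f z t)) by (intros f Cf p; cts).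
    assert (Cc : forall f : R -> R, (forall t, continuous f t) -> cont2 (fun _ t => f t)) by (intros f Cf p; cts).
    assert (CdU : forall f g k l : R -> R -> R, cont2 f -> cont2 g -> cont2 k -> cont2 l ->
      cont2 (fun z t => dU (X z t) (Y z t) (th t) (h t) (f z t) (g z t) (k z t) (l z t))).
    { intros f g' k l Cf Cg Ck Cl. destruct (CdK f g' k Cf Cg Ck) as [D0 D1].
      intros p. unfold dU.
      apply cts_minus; (apply cts_div; [try apply pow_nonzero; apply KN| |try apply cts_pow; apply CK0]); [cts|].
      apply cts_mult; [cts|apply D0]. }
    assert (CdV : forall f g k l o : R -> R -> R, cont2 f -> cont2 g -> cont2 k -> cont2 l -> cont2 o ->
      cont2 (fun z t => dV (X z t) (Y z t) (th t) (h t) (f z t) (g z t) (k z t) (l z t) (o z t))).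
    { intros f g' k l o Cf Cg Ck Cl Co. destruct (CdK f g' k Cf Cg Ck) as [D0 D1].
      intros p. unfold dV. apply cts_div; [lra| |apply cts_const].
      apply cts_minus; [|cts]. apply cts_minus; [apply cts_plus|];
        (apply cts_div; [try apply pow_nonzero; apply KN| |try apply cts_pow; apply CK0]).
      - apply cts_mult; [cts|apply CK1].
      - apply cts_mult; [cts|apply D1].
      - apply cts_mult; [apply cts_mult; [cts|apply CK1]|apply D0]. }
    assert (Z : cont2 (fun _ _ => 0)) by (intros p; apply cts_const).
    assert (Chh1 : cont2 (fun _ t => h t * h1 t)) by (intros p; cts).
    assert (Chh2 : cont2 (fun _ t => h t * h2 t)) by (intros p; cts).
    split; [|split; [|split; [|split; [|split]]]].
    + intros p. unfold u. apply cts_div; [apply KN|cts|apply CK0].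
    + exact (CdU X' Y' (fun _ _ => 0) (fun _ _ => 0) CX' CY' Z Z).
    + exact (CdU _ _ (fun _ t => h t) (fun _ t => h t * h1 t) (Cpsi' X' CX') (Cpsi' Y' CY') (Cc h Ch') Chh1).
    + intros p. unfold v. apply cts_div; [lra| |apply cts_const]. apply cts_minus; [|cts].
      apply cts_div; [apply KN| |apply CK0]. apply cts_mult; [cts|apply CK1].
    + exact (CdV X' Y' (fun _ _ => 0) (fun _ _ => 0) (fun _ _ => 0) CX' CY' Z Z Z).
    + exact (CdV _ _ (fun _ t => h t) (fun _ t => h t * h1 t) (fun _ t => h t * h2 t)
        (Cpsi' X' CX') (Cpsi' Y' CY') (Cc h Ch') Chh1 Chh2).
  - intros z t. apply U_equation, KN.
  - exists (fun t => h1 t ^ 2 / 4 - h t * h2 t / 2 - h t ^ 2).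
    intros z t. apply V_equation, KN.
  - intros t.
    assert (ST : forall f, class_C m f -> forall k, (k <= m)%nat -> class_C k (fun z => A z t) ->
      class_C k (fun z => f (A z t))).
    { intros f Hf k Hk HA. apply class_C_comp; [now apply (class_C_le m k)|exact HA]. }
    assert (SK : forall k, (k <= m)%nat -> class_C k (fun z => A z t) ->
      class_C k (fun z => K0 (X z t) (Y z t) (th t))).
    { intros k Hk HA. unfold K0. apply class_C_plus; apply class_C_pow.
      - apply class_C_plus; [apply class_C_const|]. apply class_C_mult; [now apply ST|apply class_C_const].
      - apply class_C_mult; [now apply ST|apply class_C_const]. }
    (* [A] gains one derivative at each pass: its z-derivative is [K0 / h] evaluated along [A],
       hence of class C^k whenever [A] is and [k <= m]. *)
    assert (RA : forall k, (k <= S m)%nat -> class_C k (fun z => A z t)).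
    { induction k as [|k IH]; intros Hk; [exact (cont2_l A t CA)|].
      exists (fun z => / J (A z t) t). split; [intros z; apply Az|].
      apply class_C_ext with (fun z => K0 (X z t) (Y z t) (th t) * / h t).
      - intros z. unfold J, k0. fold (X z t) (Y z t). field.
        split; [apply KN|apply Rgt_not_eq, hpos].
      - apply class_C_mult; [|apply class_C_const]. apply SK; [lia|]. apply IH. lia. }
    assert (RAm : class_C m (fun z => A z t)) by (apply RA; lia).
    assert (RK : class_C m (fun z => / K0 (X z t) (Y z t) (th t))).
    { apply class_C_inv; [intros z; apply KN|now apply SK]. }
    assert (RX : class_C m (fun z => X z t)) by now apply ST.
    assert (RY : class_C m (fun z => Y z t)) by now apply ST.
    split.
    + apply class_C_mult; [|exact RK]. apply class_C_mult; [exact RX|apply class_C_const].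
    + apply class_C_mult; [|apply class_C_const]. apply class_C_minus; [|apply class_C_const].
      apply class_C_mult; [|exact RK]. apply class_C_mult; [apply class_C_const|].
      unfold K1.
      repeat first [apply class_C_const|exact RX|exact RY|apply class_C_plus|apply class_C_mult|apply class_C_pow].
Qed.
End Lagrangian.


(** * Uniqueness *)

Lemma RInt_le_cts (f g : R -> R) a b : a <= b ->
  (forall x, continuous f x) -> (forall x, continuous g x) ->
  (forall x, a <= x <= b -> f x <= g x) -> RInt f a b <= RInt g a b.
Proof.
  intros Hab Hf Hg H. apply RInt_le; try (now apply ex_RInt_cts); [exact Hab|].
  intros x Hx. apply H. lra.
Qed.

Lemma Rabs_RInt_le_cts (f g : R -> R) a b : a <= b ->
  (forall x, continuous f x) -> (forall x, continuous g x) ->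
  (forall x, a <= x <= b -> Rabs (f x) <= g x) -> Rabs (RInt f a b) <= RInt g a b.
Proof.
  intros Hab Hf Hg H. apply Rle_trans with (RInt (fun x => Rabs (f x)) a b).
  - apply abs_RInt_le; [exact Hab|now apply ex_RInt_cts].
  - apply RInt_le_cts; [exact Hab|intros; cts|exact Hg|exact H].
Qed.

Lemma RInt_ge0_cts (f : R -> R) a b : a <= b -> (forall x, continuous f x) ->
  (forall x, 0 <= f x) -> 0 <= RInt f a b.
Proof.
  intros Hab Hf H. apply RInt_ge_0; [exact Hab|now apply ex_RInt_cts|intros; apply H].
Qed.

(** Expand the integral of [(f - D) ^ 2 >= 0], where [D] is the mean of [f]. *)
Lemma RInt_sqr_ge (f : R -> R) : (forall x, continuous f x) ->
  RInt f 0 1 ^ 2 <= RInt (fun x => f x ^ 2) 0 1.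
Proof.
  intros Hf. set (D := RInt f 0 1).
  assert (H : 0 <= RInt (fun x => (f x ^ 2 - 2 * D * f x) + D ^ 2) 0 1).
  { apply RInt_ge0_cts; [lra|intros; cts|]. intros x.
    replace (f x ^ 2 - 2 * D * f x + D ^ 2) with ((f x - D) ^ 2) by ring. apply pow2_ge_0. }
  rewrite (RInt_plus_cts (fun x => f x ^ 2 - 2 * D * f x) (fun _ => D ^ 2)) in H by (intros; cts).
  rewrite (RInt_minus_cts (fun x => f x ^ 2) (fun x => 2 * D * f x)) in H by (intros; cts).
  rewrite (RInt_scal_cts f (2 * D)), RInt_const_R in H by assumption.
  fold D in H. change (0 <= RInt (fun x => f x ^ 2) 0 1 - 2 * D * D + (1 - 0) * D ^ 2) in H. lra.
Qed.

(** The period is centred at [x0], so that [x0] is interior. The primitive is squeezed to 0 near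
    [x0], and [q x0] is its derivative there. *)
Lemma periodic1_nonneg_RInt_0 (q : R -> R) : periodic1 q -> (forall x, continuous q x) ->
  (forall x, 0 <= q x) -> RInt q 0 1 = 0 -> forall x, q x = 0.
Proof.
  intros Hp Hc H0 HI x0. set (b := x0 - / 2).
  rewrite <- (is_derive_unique _ _ _ (is_derive_RInt_cts q b Hc x0)).
  apply is_derive_unique.
  apply is_derive_ext_loc with (fun _ => 0); [|apply der_const].
  exists (mkposreal (/ 2) ltac:(lra)). intros y Hy. change (Rabs (y - x0) < / 2) in Hy.
  apply Rabs_def2 in Hy.
  pose proof (RInt_Chasles_cts q b y (b + 1) Hc) as E.
  rewrite RInt_periodic1, HI in E by assumption.
  assert (0 <= RInt q b y) by (apply RInt_ge0_cts; [unfold b; lra|assumption..]).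
  assert (0 <= RInt q y (b + 1)) by (apply RInt_ge0_cts; [unfold b; lra|assumption..]).
  eqR. lra.
Qed.

Section Energy.
Context (U1 U2 V1 V2 P1 P2 Uz1 Uz2 Vz1 Vz2 Ut1 Ut2 Vt1 Vt2 : R -> R) (M : R).
Context (HU1 : forall z, is_derive U1 z (Uz1 z)) (HU2 : forall z, is_derive U2 z (Uz2 z)).
Context (HV1 : forall z, is_derive V1 z (Vz1 z)) (HV2 : forall z, is_derive V2 z (Vz2 z)).
Context (HP1 : forall z, is_derive P1 z (- V1 z)) (HP2 : forall z, is_derive P2 z (- V2 z)).
Context (CUz1 : forall z, continuous Uz1 z) (CUz2 : forall z, continuous Uz2 z).
Context (CVz1 : forall z, continuous Vz1 z) (CVz2 : forall z, continuous Vz2 z).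
Context (CUt1 : forall z, continuous Ut1 z) (CUt2 : forall z, continuous Ut2 z).
Context (CVt1 : forall z, continuous Vt1 z) (CVt2 : forall z, continuous Vt2 z).
Context (pU1 : periodic1 U1) (pU2 : periodic1 U2) (pV1 : periodic1 V1) (pV2 : periodic1 V2).
Context (pP1 : periodic1 P1) (P0 : P1 0 = P2 0).
Context (BU1 : forall z, 0 <= z <= 1 -> Rabs (U1 z) <= M) (BU2 : forall z, 0 <= z <= 1 -> Rabs (U2 z) <= M).
Context (BV1 : forall z, 0 <= z <= 1 -> Rabs (V1 z) <= M) (BV2 : forall z, 0 <= z <= 1 -> Rabs (V2 z) <= M).
Context (BUz : forall z, 0 <= z <= 1 -> Rabs (Uz2 z) <= M) (BVz : forall z, 0 <= z <= 1 -> Rabs (Vz2 z) <= M).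

Let c1 := 3 * RInt (fun z => V1 z ^ 2) 0 1 - RInt (fun z => U1 z ^ 2) 0 1.
Let c2 := 3 * RInt (fun z => V2 z ^ 2) 0 1 - RInt (fun z => U2 z ^ 2) 0 1.

Context (EU1 : forall z, Ut1 z + 2 * P1 z * Uz1 z = - 2 * V1 z * U1 z).
Context (EU2 : forall z, Ut2 z + 2 * P2 z * Uz2 z = - 2 * V2 z * U2 z).
Context (EV1 : forall z, Vt1 z + 2 * P1 z * Vz1 z = U1 z ^ 2 - V1 z ^ 2 + c1).
Context (EV2 : forall z, Vt2 z + 2 * P2 z * Vz2 z = U2 z ^ 2 - V2 z ^ 2 + c2).

Let w z := U1 z - U2 z.
Let x z := V1 z - V2 z.
Let q z := w z ^ 2 + x z ^ 2.

(** All functions are slices at one fixed time. Writing [P1 * Uz1 - P2 * Uz2] as [P1] times the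
    derivative of [w] plus [(P1 - P2) * Uz2], the first part integrates by parts against the
    periodic [P1], so z-derivatives need a bound for the second solution only. The nonlocal
    differences [P1 - P2] and [c1 - c2] are controlled by the L^1 distance [D]. *)
Lemma energy_estimate :
  RInt (fun z => 2 * w z * (Ut1 z - Ut2 z) + 2 * x z * (Vt1 z - Vt2 z)) 0 1
  <= 44 * M * RInt q 0 1.
Proof.
  assert (CU1 : forall z, continuous U1 z) by (intros z; exact (is_derive_cts _ _ _ (HU1 z))).
  assert (CU2 : forall z, continuous U2 z) by (intros z; exact (is_derive_cts _ _ _ (HU2 z))).
  assert (CV1 : forall z, continuous V1 z) by (intros z; exact (is_derive_cts _ _ _ (HV1 z))).
  assert (CV2 : forall z, continuous V2 z) by (intros z; exact (is_derive_cts _ _ _ (HV2 z))).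
  assert (CP1 : forall z, continuous P1 z) by (intros z; exact (is_derive_cts _ _ _ (HP1 z))).
  assert (Cw : forall z, continuous w z) by (intros z; unfold w; cts).
  assert (Cx : forall z, continuous x z) by (intros z; unfold x; cts).
  assert (Cq : forall z, continuous q z) by (intros z; unfold q; cts).
  assert (M0 : 0 <= M) by (apply Rle_trans with (1 := Rabs_pos (U1 0)), BU1; lra).
  set (E := RInt q 0 1).
  set (D := RInt (fun z => Rabs (w z) + Rabs (x z)) 0 1).
  assert (D0 : 0 <= D).
  { apply RInt_ge0_cts; [lra|intros; cts|]. intros z.
    pose proof (Rabs_pos (w z)). pose proof (Rabs_pos (x z)). lra. }
  assert (DE : D ^ 2 <= 2 * E).
  { unfold E. rewrite <- RInt_scal_cts by exact Cq.
    apply Rle_trans with (RInt (fun z => (Rabs (w z) + Rabs (x z)) ^ 2) 0 1).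
    - apply RInt_sqr_ge. intros; cts.
    - apply RInt_le_cts; [lra|intros; cts|intros; cts|].
      intros z _. unfold q. rewrite <- (pow2_abs (w z)), <- (pow2_abs (x z)).
      pose proof (pow2_ge_0 (Rabs (w z) - Rabs (x z))). lra. }
  assert (dP : forall z, 0 <= z <= 1 -> Rabs (P1 z - P2 z) <= D).
  { intros z Hz.
    assert (Ei : RInt (fun y => - x y) 0 z = (P1 z - P2 z) - (P1 0 - P2 0)).
    { apply (RInt_of_derive (fun y => P1 y - P2 y)); [|intros; cts].
      intros y. pose proof (HP1 y). pose proof (HP2 y). der. unfold x. ring. }
    replace (P1 z - P2 z) with (RInt (fun y => - x y) 0 z) by (rewrite Ei, P0; eqR; ring).
    assert (S : RInt (fun y => Rabs (w y) + Rabs (x y)) 0 z <= D).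
    { unfold D. rewrite <- (RInt_Chasles_cts (fun y => Rabs (w y) + Rabs (x y)) 0 z 1) by (intros; cts).
      pose proof (RInt_ge0_cts (fun y => Rabs (w y) + Rabs (x y)) z 1) as S.
      assert (0 <= RInt (fun y => Rabs (w y) + Rabs (x y)) z 1).
      { apply S; [lra|intros; cts|]. intros y. pose proof (Rabs_pos (w y)). pose proof (Rabs_pos (x y)). lra. }
      lra. }
    apply Rle_trans with (2 := S).
    apply Rabs_RInt_le_cts; [lra|intros; cts|intros; cts|].
    intros y _. rewrite Rabs_Ropp. pose proof (Rabs_pos (w y)). lra. }
  assert (dc : Rabs (c1 - c2) <= 6 * M * D).
  { assert (Ec : c1 - c2 = RInt (fun z => 3 * (V1 z ^ 2 - V2 z ^ 2) - (U1 z ^ 2 - U2 z ^ 2)) 0 1).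
    { rewrite (RInt_minus_cts (fun z => 3 * (V1 z ^ 2 - V2 z ^ 2)) (fun z => U1 z ^ 2 - U2 z ^ 2)) by (intros; cts).
      rewrite (RInt_scal_cts (fun z => V1 z ^ 2 - V2 z ^ 2)) by (intros; cts).
      rewrite (RInt_minus_cts (fun z => V1 z ^ 2) (fun z => V2 z ^ 2)) by (intros; cts).
      rewrite (RInt_minus_cts (fun z => U1 z ^ 2) (fun z => U2 z ^ 2)) by (intros; cts).
      unfold c1, c2. eqR. ring. }
    rewrite Ec. unfold D. rewrite <- (RInt_scal_cts (fun z => Rabs (w z) + Rabs (x z))) by (intros; cts).
    apply Rabs_RInt_le_cts; [lra|intros; cts|intros; cts|].
    intros z Hz.
    replace (3 * (V1 z ^ 2 - V2 z ^ 2) - (U1 z ^ 2 - U2 z ^ 2)) with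
      (3 * (x z * (V1 z + V2 z)) - w z * (U1 z + U2 z)) by (unfold x, w; ring).
    assert (A1 : Rabs (V1 z + V2 z) <= 2 * M).
    { apply Rle_trans with (1 := Rabs_triang _ _). pose proof (BV1 z Hz). pose proof (BV2 z Hz). lra. }
    assert (A2 : Rabs (U1 z + U2 z) <= 2 * M).
    { apply Rle_trans with (1 := Rabs_triang _ _). pose proof (BU1 z Hz). pose proof (BU2 z Hz). lra. }
    pose proof (Rabs_mult_le _ _ _ _ (Rle_refl (Rabs (x z))) A1) as A3.
    pose proof (Rabs_mult_le _ _ _ _ (Rle_refl (Rabs (w z))) A2) as A4.
    apply Rle_trans with (1 := Rabs_triang _ _).
    rewrite Rabs_Ropp, Rabs_mult, (Rabs_pos_eq 3) by lra.
    pose proof (Rmult_le_pos _ _ M0 (Rabs_pos (w z))). lra. }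
  (* [S] is the z-derivative of [P1 * q], so it has zero integral; it absorbs the only terms with
     derivatives of [w] and [x]. *)
  pose (S := fun z => - V1 z * q z + P1 z * (2 * w z * (Uz1 z - Uz2 z) + 2 * x z * (Vz1 z - Vz2 z))).
  assert (CS : forall z, continuous S z) by (intros z; unfold S; cts).
  assert (IS : RInt S 0 1 = 0).
  { rewrite (RInt_of_derive (fun z => P1 z * q z)); [|intros z|exact CS].
    - unfold q, w, x.
      assert (per : forall f, periodic1 f -> f 1 = f 0) by (intros f Hf; rewrite <- (Hf 0); f_equal; ring).
      rewrite !(per _ pU1), !(per _ pU2), !(per _ pV1), !(per _ pV2), !(per _ pP1). eqR. ring.
    - pose proof (HU1 z). pose proof (HU2 z). pose proof (HV1 z). pose proof (HV2 z). pose proof (HP1 z).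
      unfold q, w, x. der. unfold S, q, w, x. ring. }
  (* The constant 24 is 2 from [V1 * q] plus 22 from the other terms. After integration,
     [D ^ 2 <= 2 * E] turns [24 + 10 * 2] into 44. *)
  assert (pt : forall z, 0 <= z <= 1 ->
    2 * w z * (Ut1 z - Ut2 z) + 2 * x z * (Vt1 z - Vt2 z)
    <= - 2 * S z + (24 * M * q z + 10 * M * D ^ 2)).
  { intros z Hz.
    pose proof (dP z Hz) as hP.
    pose proof (BU1 z Hz) as b1. pose proof (BU2 z Hz) as b2.
    pose proof (BV1 z Hz) as b3. pose proof (BV2 z Hz) as b4.
    pose proof (BUz z Hz) as b5. pose proof (BVz z Hz) as b6.
    assert (Id : 2 * w z * (Ut1 z - Ut2 z) + 2 * x z * (Vt1 z - Vt2 z) =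
      - 2 * S z - 2 * (V1 z * q z) - 4 * ((P1 z - P2 z) * (w z * Uz2 z + x z * Vz2 z))
      - 4 * (w z * (V1 z * w z + U2 z * x z))
      + 2 * (x z * ((U1 z + U2 z) * w z - (V1 z + V2 z) * x z + (c1 - c2)))).
    { replace (Ut1 z) with (- 2 * V1 z * U1 z - 2 * P1 z * Uz1 z) by (rewrite <- EU1; ring).
      replace (Ut2 z) with (- 2 * V2 z * U2 z - 2 * P2 z * Uz2 z) by (rewrite <- EU2; ring).
      replace (Vt1 z) with (U1 z ^ 2 - V1 z ^ 2 + c1 - 2 * P1 z * Vz1 z) by (rewrite <- EV1; ring).
      replace (Vt2 z) with (U2 z ^ 2 - V2 z ^ 2 + c2 - 2 * P2 z * Vz2 z) by (rewrite <- EV2; ring).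
      unfold S, q, w, x. ring. }
    rewrite Id.
    assert (Eq : q z = Rabs (w z) ^ 2 + Rabs (x z) ^ 2) by (unfold q; now rewrite !pow2_abs).
    pose proof (Rabs_pos (w z)) as a0. pose proof (Rabs_pos (x z)) as a0'.
    assert (q0 : 0 <= q z) by (rewrite Eq; nra).
    assert (lo : forall y B, Rabs y <= B -> - y <= B /\ y <= B).
    { intros y B Hy. apply Rabs_le_between in Hy. lra. }
    assert (T1 : Rabs (V1 z * q z) <= M * q z).
    { apply Rabs_mult_le; [exact b3|]. rewrite Rabs_pos_eq; lra. }
    assert (T2 : Rabs ((P1 z - P2 z) * (w z * Uz2 z + x z * Vz2 z)) <= D * (Rabs (w z) * M + Rabs (x z) * M)).
    { apply Rabs_mult_le; [exact hP|]. apply Rle_trans with (1 := Rabs_triang _ _).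
      apply Rplus_le_compat; apply Rabs_mult_le; (apply Rle_refl || assumption). }
    assert (T3 : Rabs (w z * (V1 z * w z + U2 z * x z)) <= Rabs (w z) * (M * Rabs (w z) + M * Rabs (x z))).
    { apply Rabs_mult_le; [apply Rle_refl|]. apply Rle_trans with (1 := Rabs_triang _ _).
      apply Rplus_le_compat; apply Rabs_mult_le; (apply Rle_refl || assumption). }
    assert (T4 : Rabs (x z * ((U1 z + U2 z) * w z - (V1 z + V2 z) * x z + (c1 - c2)))
      <= Rabs (x z) * (2 * M * Rabs (w z) + 2 * M * Rabs (x z) + 6 * M * D)).
    { apply Rabs_mult_le; [apply Rle_refl|]. apply Rle_trans with (1 := Rabs_triang _ _).
      apply Rplus_le_compat; [|exact dc].
      apply Rle_trans with (1 := Rabs_triang _ _). rewrite Rabs_Ropp.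
      apply Rplus_le_compat; apply Rabs_mult_le; try apply Rle_refl;
        apply Rle_trans with (1 := Rabs_triang _ _); lra. }
    apply lo in T1. apply lo in T2. apply lo in T3. apply lo in T4.
    set (a := Rabs (w z)) in *. set (b := Rabs (x z)) in *.
    (* The cross terms total [4 * D * a + 16 * D * b], at most [2 * (D^2 + a^2) + 8 * (D^2 + b^2)];
       this is where 10 comes from. *)
    assert (F : 0 <= M * (22 * (a ^ 2 + b ^ 2) + 10 * D ^ 2 - 4 * D * (a + b) - 4 * a * (a + b)
      - 2 * b * (2 * a + 2 * b + 6 * D))).
    { apply Rmult_le_pos; [exact M0|].
      pose proof (pow2_ge_0 (D - a)). pose proof (pow2_ge_0 (D - b)). pose proof (pow2_ge_0 (a - b)).
      pose proof (pow2_ge_0 a). pose proof (pow2_ge_0 b). lra. }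
    rewrite Eq in *. lra. }
  apply Rle_trans with (RInt (fun z => - 2 * S z + (24 * M * q z + 10 * M * D ^ 2)) 0 1).
  - apply RInt_le_cts; [lra|intros; cts|intros; cts|exact pt].
  - rewrite (RInt_plus_cts (fun z => - 2 * S z) (fun z => 24 * M * q z + 10 * M * D ^ 2)) by (intros; cts).
    rewrite (RInt_plus_cts (fun z => 24 * M * q z) (fun _ => 10 * M * D ^ 2)) by (intros; cts).
    rewrite !RInt_scal_cts, IS, RInt_const_R by assumption. fold E.
    pose proof (Rmult_le_compat_l _ _ _ M0 DE).
    change (-2 * 0 + (24 * M * E + (1 - 0) * (10 * M * D ^ 2)) <= 44 * M * E). lra.
Qed.
End Energy.


Lemma is_derive_clamp (f : R -> R) t l :
  0 < t -> is_derive_t f t l -> is_derive (fun s => f (Rmax 0 s)) t l.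
Proof.
  intros Ht H. apply is_derive_ext_loc with f; [|now apply is_derive_of_is_derive_t].
  apply (filter_imp (F := locally t)) with (fun s => 0 < s); [|exact (open_gt 0 t Ht)].
  intros s Hs. rewrite Rmax_right; [reflexivity|lra].
Qed.

Lemma solution_unique (a u0 v0 : R -> R) (u1 v1 p1 u2 v2 p2 : R -> R -> R) :
  is_solution a u0 v0 u1 v1 p1 -> is_solution a u0 v0 u2 v2 p2 ->
  forall z t, 0 <= t -> u1 z t = u2 z t /\ v1 z t = v2 z t.
Proof.
  intros (I1 & Per1 & Psi1 & A1 & uz1 & ut1 & vz1 & vt1 & CU1 & CV1 & Eq1)
         (I2 & Per2 & Psi2 & A2 & uz2 & ut2 & vz2 & vt2 & CU2 & CV2 & Eq2) z0 T HT.
  destruct CU1 as (dzu1 & dtu1 & cu1 & cuz1 & cut1). destruct CV1 as (dzv1 & dtv1 & cv1 & cvz1 & cvt1).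
  destruct CU2 as (dzu2 & dtu2 & cu2 & cuz2 & cut2). destruct CV2 as (dzv2 & dtv2 & cv2 & cvz2 & cvt2).
  apply cont2_of_continuous_half_plane in cu1, cuz1, cut1, cv1, cvz1, cvt1, cu2, cuz2, cut2, cv2, cvz2, cvt2.
  (* Clamped differences are continuous on the plane, so the energy is continuous up to time 0,
     while its derivative is used only at positive times. *)
  pose (w := fun z t => u1 z (Rmax 0 t) - u2 z (Rmax 0 t)).
  pose (x := fun z t => v1 z (Rmax 0 t) - v2 z (Rmax 0 t)).
  pose (q := fun z t => w z t ^ 2 + x z t ^ 2).
  pose (qt := fun z t => 2 * w z t * (ut1 z (Rmax 0 t) - ut2 z (Rmax 0 t))
    + 2 * x z t * (vt1 z (Rmax 0 t) - vt2 z (Rmax 0 t))).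
  assert (Cw : cont2 w) by (intros p; exact (cts_minus _ _ p (cu1 p) (cu2 p))).
  assert (Cx : cont2 x) by (intros p; exact (cts_minus _ _ p (cv1 p) (cv2 p))).
  assert (Cq : cont2 q) by (intros p; unfold q; cts).
  assert (Cqt : cont2 qt).
  { intros p. unfold qt. pose proof (cts_minus _ _ p (cut1 p) (cut2 p)).
    pose proof (cts_minus _ _ p (cvt1 p) (cvt2 p)).
    apply cts_plus; (apply cts_mult; [cts|assumption]). }
  pose (E := fun t => RInt (fun z => q z t) 0 1).
  pose (dE := fun t => RInt (fun z => qt z t) 0 1).
  assert (HE : forall s, 0 < s -> is_derive E s (dE s)).
  { intros s Hs. apply is_derive_RInt_cont2; [|exact Cq|exact Cqt].
    apply (filter_imp (F := locally s)) with (fun s => 0 < s); [|exact (open_gt 0 s Hs)].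
    intros r Hr z.
    pose proof (is_derive_clamp _ _ _ Hr (dtu1 z r (Rlt_le _ _ Hr))).
    pose proof (is_derive_clamp _ _ _ Hr (dtu2 z r (Rlt_le _ _ Hr))).
    pose proof (is_derive_clamp _ _ _ Hr (dtv1 z r (Rlt_le _ _ Hr))).
    pose proof (is_derive_clamp _ _ _ Hr (dtv2 z r (Rlt_le _ _ Hr))).
    unfold q, w, x. der. unfold qt, w, x. rewrite !(Rmax_right 0 r) by lra. ring. }
  destruct (cont2_bounded _ 0 1 0 T cu1) as (M1 & M1p & B1).
  destruct (cont2_bounded _ 0 1 0 T cu2) as (M2 & M2p & B2).
  destruct (cont2_bounded _ 0 1 0 T cv1) as (M3 & M3p & B3).
  destruct (cont2_bounded _ 0 1 0 T cv2) as (M4 & M4p & B4).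
  destruct (cont2_bounded _ 0 1 0 T cuz2) as (M5 & M5p & B5).
  destruct (cont2_bounded _ 0 1 0 T cvz2) as (M6 & M6p & B6).
  set (M := M1 + M2 + M3 + M4 + M5 + M6).
  assert (HdE : forall s, 0 < s < T -> dE s <= 44 * M * E s).
  { intros s Hs. assert (Hs0 : 0 <= Rmax 0 s) by apply Rmax_l.
    assert (HsT : 0 <= s <= T) by lra.
    destruct (Per1 _ Hs0) as (pu1 & pv1 & pp1). destruct (Per2 _ Hs0) as (pu2 & pv2 & pp2).
    apply (energy_estimate (fun z => u1 z (Rmax 0 s)) (fun z => u2 z (Rmax 0 s))
      (fun z => v1 z (Rmax 0 s)) (fun z => v2 z (Rmax 0 s))
      (fun z => p1 z (Rmax 0 s)) (fun z => p2 z (Rmax 0 s))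
      (fun z => uz1 z (Rmax 0 s)) (fun z => uz2 z (Rmax 0 s))
      (fun z => vz1 z (Rmax 0 s)) (fun z => vz2 z (Rmax 0 s))
      (fun z => ut1 z (Rmax 0 s)) (fun z => ut2 z (Rmax 0 s))
      (fun z => vt1 z (Rmax 0 s)) (fun z => vt2 z (Rmax 0 s)) M);
    try assumption; try (intros z; auto; fail).
    - exact (cont2_l _ s cuz1).
    - exact (cont2_l _ s cuz2).
    - exact (cont2_l _ s cvz1).
    - exact (cont2_l _ s cvz2).
    - exact (cont2_l _ s cut1).
    - exact (cont2_l _ s cut2).
    - exact (cont2_l _ s cvt1).
    - exact (cont2_l _ s cvt2).
    - now rewrite A1, A2.
    - intros z Hz. apply Rle_trans with (1 := B1 z s Hz HsT). unfold M. lra.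
    - intros z Hz. apply Rle_trans with (1 := B2 z s Hz HsT). unfold M. lra.
    - intros z Hz. apply Rle_trans with (1 := B3 z s Hz HsT). unfold M. lra.
    - intros z Hz. apply Rle_trans with (1 := B4 z s Hz HsT). unfold M. lra.
    - intros z Hz. apply Rle_trans with (1 := B5 z s Hz HsT). unfold M. lra.
    - intros z Hz. apply Rle_trans with (1 := B6 z s Hz HsT). unfold M. lra.
    - intros z. apply Eq1, Hs0.
    - intros z. apply Eq2, Hs0.
    - intros z. apply Eq1, Hs0.
    - intros z. apply Eq2, Hs0. }
  assert (q0 : forall z t, 0 <= q z t).
  { intros z t. apply Rplus_le_le_0_compat; apply pow2_ge_0. }
  assert (E0 : E 0 = 0).
  { unfold E. rewrite (RInt_ext _ (fun _ => 0)).
    - rewrite RInt_const_R. eqR. ring.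
    - intros z _. unfold q, w, x. rewrite Rmax_left by lra.
      destruct (I1 z) as [-> ->]. destruct (I2 z) as [-> ->]. eqR. ring. }
  pose proof (gronwall E dE (44 * M) 0 T HT (continuous_RInt_cont2 q 0 1 Cq)
    (fun s Hs => HE s (proj1 Hs)) HdE) as G.
  rewrite E0, Rmult_0_l in G.
  assert (ET : 0 <= E T) by (apply RInt_ge0_cts; [lra|now apply cont2_l|intros; apply q0]).
  assert (Q : q z0 T = 0).
  { apply (periodic1_nonneg_RInt_0 (fun z => q z T)).
    - intros z. unfold q, w, x.
      destruct (Per1 _ (Rmax_l 0 T)) as (pu1 & pv1 & _). destruct (Per2 _ (Rmax_l 0 T)) as (pu2 & pv2 & _).
      now rewrite (pu1 z), (pv1 z), (pu2 z), (pv2 z).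
    - now apply cont2_l.
    - intros z. apply q0.
    - apply Rle_antisym; assumption. }
  unfold q, w, x in Q. rewrite Rmax_right in Q by exact HT.
  pose proof (pow2_ge_0 (u1 z0 T - u2 z0 T)). pose proof (pow2_ge_0 (v1 z0 T - v2 z0 T)).
  split; apply Rminus_diag_uniq, Rsqr_0_uniq; unfold Rsqr; lra.
Qed.

(** * Identification of c(t) and conclusion *)

Lemma C1_half_plane_of_cont2 (f fz ft : R -> R -> R) :
  (forall z t, is_derive (fun y => f y t) z (fz z t)) ->
  (forall z t, is_derive (f z) t (ft z t)) ->
  cont2 f -> cont2 fz -> cont2 ft -> C1_half_plane f fz ft.
Proof.
  intros Hz Ht Cf Cfz Cft. split; [intros z t _; apply Hz|]. split.
  - intros z t H. apply is_derive_t_of_is_derive; [exact H|apply Ht].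
  - split; [|split]; now apply continuous_half_plane_of_cont2.
Qed.

(** Integrate the v-equation over a period. Periodicity of psi gives [v] zero mean at every time, so
    [vt] has zero mean too; by parts, the integral of [2 * psi * vz] is twice that of [v ^ 2].
    Together with the [- v ^ 2] on the right this produces the factor 3. *)
Lemma c_of_eq (u v vz vt psi : R -> R -> R) (c : R) t :
  (forall z s, is_derive (fun y => psi y s) z (- v z s)) ->
  (forall s, periodic1 (fun z => psi z s)) ->
  periodic1 (fun z => v z t) ->
  (forall z s, is_derive (v z) s (vt z s)) ->
  (forall z, is_derive (fun y => v y t) z (vz z t)) ->
  cont2 u -> cont2 v -> cont2 vz -> cont2 vt ->
  (forall z, vt z t + 2 * psi z t * vz z t = u z t ^ 2 - v z t ^ 2 + c) ->
  c = c_of u v t.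
Proof.
  intros Hpsi ppsi pv Hvt Hvz Cu Cv Cvz Cvt Heq.
  assert (per : forall f, periodic1 f -> f 1 = f 0) by (intros f Hf; rewrite <- (Hf 0); f_equal; ring).
  assert (V0 : forall s, RInt (fun z => v z s) 0 1 = 0).
  { intros s.
    assert (E : RInt (fun z => - 1 * - v z s) 0 1 = - 1 * (psi 1 s - psi 0 s)).
    { rewrite (RInt_scal_cts (fun z => - v z s)) by (intros; cts).
      rewrite (RInt_of_derive (fun z => psi z s)); [reflexivity|intros; apply Hpsi|intros; cts]. }
    rewrite (per (fun z => psi z s)) in E by apply ppsi.
    rewrite (RInt_ext _ (fun z => v z s)) in E by (intros; eqR; ring).
    rewrite E. eqR. ring. }
  assert (Vt : RInt (fun z => vt z t) 0 1 = 0).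
  { assert (D : is_derive (fun s => RInt (fun z => v z s) 0 1) t (RInt (fun z => vt z t) 0 1)).
    { apply is_derive_RInt_cont2; [|assumption..]. apply filter_forall. intros s z. apply Hvt. }
    rewrite <- (is_derive_unique _ _ _ D). apply is_derive_unique.
    apply is_derive_ext with (fun _ => 0); [intros s; now rewrite V0|apply der_const]. }
  assert (Cpsi : forall z, continuous (fun y => psi y t) z).
  { intros z. exact (is_derive_cts _ _ _ (Hpsi z t)). }
  assert (Cvz' := cont2_l vz t Cvz). assert (Cv' := cont2_l v t Cv). assert (Cu' := cont2_l u t Cu).
  assert (IBP : RInt (fun z => - v z t * v z t + psi z t * vz z t) 0 1 = 0).
  { rewrite (RInt_of_derive (fun z => psi z t * v z t)).
    - rewrite (per (fun z => psi z t)), (per (fun z => v z t)) by auto. eqR. ring.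
    - intros z. pose proof (Hpsi z t). pose proof (Hvz z). der. ring.
    - intros z. apply cts_plus; [cts|]. apply cts_mult; [apply Cpsi|cts]. }
  assert (I : RInt (fun z => vt z t - (u z t ^ 2 + - 3 * v z t ^ 2)
      + 2 * (- v z t * v z t + psi z t * vz z t)) 0 1 = c).
  { rewrite (RInt_ext _ (fun _ => c)).
    - rewrite RInt_const_R. eqR. ring.
    - intros z _. pose proof (Heq z). eqR. lra. }
  assert (Cw : forall z, continuous (fun z => - v z t * v z t + psi z t * vz z t) z).
  { intros z. apply cts_plus; [cts|]. apply cts_mult; [apply Cpsi|cts]. }
  rewrite (RInt_plus_cts (fun z => vt z t - (u z t ^ 2 + - 3 * v z t ^ 2))
    (fun z => 2 * (- v z t * v z t + psi z t * vz z t))) in I.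
  2: intros; cts.
  2: intros; apply cts_mult; [apply cts_const|apply Cw].
  rewrite (RInt_minus_cts (fun z => vt z t) (fun z => u z t ^ 2 + - 3 * v z t ^ 2)) in I by (intros; cts).
  rewrite (RInt_plus_cts (fun z => u z t ^ 2) (fun z => - 3 * v z t ^ 2)) in I by (intros; cts).
  rewrite (RInt_scal_cts (fun z => v z t ^ 2)) in I by (intros; cts).
  rewrite (RInt_scal_cts (fun z => - v z t * v z t + psi z t * vz z t)), IBP, Vt in I by exact Cw.
  rewrite <- I. unfold c_of. eqR. ring.
Qed.

Theorem theorem3 (m : nat) (hm : (1 <= m)%nat) (a u0 v0 : R -> R)
  (ha : continuous_on (fun t : R => 0 <= t) a)
  (hu0 : Cm m u0) (hv0 : Cm m v0)
  (pu0 : periodic1 u0) (pv0 : periodic1 v0)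
  (hmean : RInt v0 0 1 = 0) :
  exists u v psi : R -> R -> R,
    is_solution a u0 v0 u v psi /\
    (forall t, 0 <= t -> Cm m (fun z => u z t) /\ Cm m (fun z => v z t)) /\
    (forall u' v' psi' : R -> R -> R, is_solution a u0 v0 u' v' psi' ->
       forall z t, 0 <= t -> u' z t = u z t /\ v' z t = v z t).
Proof.
  apply class_C_of_Cm in hu0, hv0.
  (* [1 <= m] supplies the continuous derivatives, hence the Lipschitz bounds on which the angle
     equation rests. *)
  destruct (class_C_le m 1 u0 hm hu0) as (du & Hdu & Cdu).
  destruct (class_C_le m 1 v0 hm hv0) as (dv & Hdv & Cdv).
  pose proof (class_C_cts _ _ hu0) as Cu. pose proof (class_C_cts _ _ hv0) as Cv.
  destruct (periodic1_bounded u0 pu0 Cu) as (M1 & M1p & B1).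
  destruct (periodic1_bounded v0 pv0 Cv) as (M2 & M2p & B2).
  destruct (periodic1_C1_lipschitz u0 du pu0 Hdu Cdu) as (N1 & N1p & L1).
  destruct (periodic1_C1_lipschitz v0 dv pv0 Hdv Cdv) as (N2 & N2p & L2).
  assert (Bu : forall x, Rabs (u0 x) <= M1 + M2) by (intros x; pose proof (B1 x); lra).
  assert (Bv : forall x, Rabs (v0 x) <= M1 + M2) by (intros x; pose proof (B2 x); lra).
  assert (N0 : 0 <= N1 + N2) by lra.
  assert (Lu : forall x y, Rabs (u0 x - u0 y) <= (N1 + N2) * Rabs (x - y)).
  { intros x y. pose proof (L1 x y). pose proof (Rmult_le_pos _ _ N2p (Rabs_pos (x - y))). lra. }
  assert (Lv : forall x y, Rabs (v0 x - v0 y) <= (N1 + N2) * Rabs (x - y)).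
  { intros x y. pose proof (L2 x y). pose proof (Rmult_le_pos _ _ N1p (Rabs_pos (x - y))). lra. }
  destruct (angle_exists u0 v0 _ _ Bu Bv N0 Lu Lv Cu Cv pu0 pv0) as (th & h & th0 & Hth & hpos & Kpos & hK).
  (* The prescribed [a] is extended to negative times by its value at 0, so that the flow can be
     built for all real times. *)
  destruct (lagrangian_solution u0 v0 du dv th h Hdu Hdv Cdu Cdv pu0 pv0 hmean th0 Hth hpos Kpos hK
    (fun t => a (Rmax 0 t)) (continuous_of_continuous_on a ha) _ _ Bu Bv N0 Lu Lv m hu0 hv0)
    as (u & v & psi & uz & ut & vz & vt & Init & Per & Psi & P0 & Uz & Ut & Vz & Vt
      & (CU & CUz & CUt & CV & CVz & CVt) & EU & (c & EV) & Reg).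
  assert (Sol : is_solution a u0 v0 u v psi).
  { split; [exact Init|]. split; [intros t _; apply Per|]. split; [intros z t _; apply Psi|].
    split; [intros t Ht; rewrite P0, Rmax_right; [reflexivity|exact Ht]|].
    exists uz, ut, vz, vt. split; [now apply C1_half_plane_of_cont2|].
    split; [now apply C1_half_plane_of_cont2|].
    intros z t _. split; [apply EU|].
    rewrite <- (c_of_eq u v vz vt psi (c t) t); auto; intros; apply Per. }
  exists u, v, psi. split; [exact Sol|]. split.
  - intros t _. destruct (Reg t). split; now apply Cm_of_class_C.
  - intros u' v' psi' Sol'. exact (solution_unique a u0 v0 u' v' psi' u v psi Sol' Sol).
Qed.
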